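(* Let $\theta$ be an inner function and $g \in L^\infty(\mathbb{T})$. If $\ker A_g^\theta$ contains functions which do not vanish at $0$, then $\ker A_g^\theta$ is nearly $S^*$-invariant.
   Context: $H^2$ is the Hardy space of the unit disc, identified with its boundary functions in $L^2=L^2(\mathbb{T})$; $\overline{H^2_0} = \{\overline f : f\in H^2, f(0)=0\}$. For an inner function $\theta$, $K_\theta = \theta\overline{H^2_0}\cap H^2$ and $P_\theta:L^2\to K_\theta$ is the orthogonal projection. For $g\in L^\infty$, the truncated Toeplitz operator $A_g^\theta : K_\theta\to K_\theta$ is $A_g^\theta(f)=P_\theta(gf)$. The backward shift is $S^*f(z)=(f(z)-f(0))/z$. A closed subspace $M\subseteq H^2$ is nearly $S^*$-invariant if $S^*f\in M$ whenever $f\in M$ and $f(0)=0$. *)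

(* Defs.v *)
From HB Require Import structures.
From mathcomp Require Import all_boot all_order all_algebra.
From mathcomp Require Import all_classical all_reals all_analysis.
From mathcomp.real_closed Require Import complex.

Set Implicit Arguments.
Unset Strict Implicit.
Unset Printing Implicit Defensive.

Import Order.TTheory GRing.Theory Num.Theory numFieldNormedType.Exports.

Local Open Scope classical_set_scope.
Local Open Scope ring_scope.
Local Open Scope complex_scope.

(* A function on the unit circle T is represented by f : R -> R[i], where f t
   is the value at the point e^{it}; only t in [0, 2 pi] matters, and such
   functions are identified when they agree almost everywhere there.  A function
   on the open unit disc D is represented by F : R[i] -> R[i]; only the values
   at |z| < 1 matter. *)

Section Circle.
Variable R : realType.
Implicit Types (t : R) (f h : R -> R[i]).

Definition cis t : R[i] := cos t +i* sin t.

Definition circle : set R := `[0, 2 * pi].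

Definition ae_circle (P : R -> Prop) : Prop :=
  {ae @lebesgue_measure R, forall t, circle t -> P t}.

Definition measurable_circle f : Prop :=
  measurable_fun circle (fun t => complex.Re (f t)) /\
  measurable_fun circle (fun t => complex.Im (f t)).

(* squared norm of L^2(T) for the normalised arc length dt / (2 pi) *)
Definition L2normsq f : \bar R :=
  (((2 * pi)^-1)%:E *
   \int[@lebesgue_measure R]_(t in circle) ((Normc.normc (f t)) ^+ 2)%:E)%E.

Definition L2 : set (R -> R[i]) :=
  [set f | measurable_circle f /\ (L2normsq f < +oo)%E].

Definition Linfty : set (R -> R[i]) :=
  [set g | measurable_circle g /\
           exists C : R, ae_circle (fun t => Normc.normc (g t) <= C)].

Definition circle_integral f : R[i] :=
  (\int[@lebesgue_measure R]_(t in circle) (complex.Re (f t)))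
  +i* (\int[@lebesgue_measure R]_(t in circle) (complex.Im (f t))).

Definition L2inner f h : R[i] :=
  ((2 * pi)^-1)%:C * circle_integral (fun t => f t * (h t)^*%C).

Definition L2cvg (u : nat -> R -> R[i]) f : Prop :=
  L2normsq (fun t => u n t - f t) @[n --> \oo] --> 0%E.

Definition closed_subspace (M : set (R -> R[i])) : Prop :=
  [/\ M (fun=> 0),
      (forall f h, M f -> M h -> M (fun t => f t + h t)),
      (forall (c : R[i]) f, M f -> M (fun t => c * f t)) &
      (forall (u : nat -> R -> R[i]) f,
         (forall n, M (u n)) -> L2 f -> L2cvg u f -> M f)].

(* k is (a representative of) the orthogonal projection of h on K.  The k
   satisfying this form a single almost-everywhere class when K is a closed
   subspace of L^2(T). *)
Definition is_orth_proj (K : set (R -> R[i])) h k : Prop :=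
  K k /\ forall psi, K psi -> L2inner (fun t => h t - k t) psi = 0.

End Circle.

Section Hardy.
Variable R : realType.
Implicit Types (F : R[i] -> R[i]) (f g h theta : R -> R[i]).

Definition analytic_disc F : Prop :=
  exists a : nat -> R[i], forall z : R[i], `|z| < 1 ->
    series (fun n => a n * z ^+ n) @ \oo --> (F z : R[i]^o).

Definition dilate F (r : R) : R -> R[i] := fun t => F (r%:C * cis t).

Definition hardy2 F : Prop :=
  analytic_disc F /\
  exists C : R, forall r : R, 0 <= r < 1 -> (L2normsq (dilate F r) <= C%:E)%E.

(* f in L^2(T) is the boundary function of F in H^2 *)
Definition boundary F f : Prop :=
  [/\ hardy2 F, L2 f &
      L2normsq (fun t => dilate F r t - f t) @[r --> 1^'-] --> 0%E].

Definition H2 : set (R -> R[i]) := [set f | exists F, boundary F f].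

Definition H20 : set (R -> R[i]) :=
  [set f | exists2 F, boundary F f & F 0 = 0].

(* the elements of M, a set of boundary functions, as functions on the disc *)
Definition disc_functions (M : set (R -> R[i])) : set (R[i] -> R[i]) :=
  [set F | exists2 f, boundary F f & M f].

Definition inner_function theta : Prop :=
  (exists2 F, boundary F theta &
     exists C : R, forall z : R[i], `|z| < 1 -> Normc.normc (F z) <= C) /\
  ae_circle (fun t => Normc.normc (theta t) = 1).

Definition model_space theta : set (R -> R[i]) :=
  [set f | H2 f /\
     exists2 h, H20 h & ae_circle (fun t => f t = theta t * (h t)^*%C)].

(* the graph of the truncated Toeplitz operator: h represents A_g^theta f *)
Definition truncated_toeplitz theta g f h : Prop :=
  model_space theta f /\
  is_orth_proj (model_space theta) (fun t => g t * f t) h.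

Definition ker_truncated_toeplitz theta g : set (R -> R[i]) :=
  [set f | truncated_toeplitz theta g f (fun=> 0)].

(* the singularity of (F z - F 0) / z at 0 is removed by the value F'(0) *)
Definition backward_shift F : R[i] -> R[i] := fun z =>
  if z == 0 then derive1 (F : R[i]^o -> R[i]^o) 0 else (F z - F 0) / z.

Definition nearly_Sstar_invariant (M : set (R -> R[i])) : Prop :=
  [/\ M `<=` H2, closed_subspace M &
      forall F, disc_functions M F -> F 0 = 0 ->
        disc_functions M (backward_shift F)].

End Hardy.

(* Main.v *)
Require Import Defs.
From mathcomp Require Import all_boot all_order all_algebra.
From mathcomp Require Import all_classical all_reals all_analysis.
From mathcomp Require Import measurable_realfun.
From mathcomp.real_closed Require Import complex.
From mathcomp Require Import ring lra.
Import Order.TTheory GRing.Theory Num.Theory numFieldNormedType.Exports.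
Set Implicit Arguments.
Unset Strict Implicit.
Unset Printing Implicit Defensive.
Local Open Scope classical_set_scope.
Local Open Scope ring_scope.
Local Open Scope complex_scope.

(** Write u^* for complex conjugation, z for the coordinate e^{it} and K for
    the model space of theta.  As theta is unimodular on the circle,
    f = theta h^* is equivalent to h = theta f^*, and f lies in the kernel of
    A_g exactly when f is in K and <g f, psi> = 0 for all psi in K.

    Near invariance.  Let f be in the kernel with f(0) = 0.  The boundary
    function of S^* f is z^* f, which is again in K, and <g z^* f, psi> =
    <g f, z psi>.  For psi in K the function z psi leaves K only by a multiple
    of theta: some z psi - c theta is in K ([shift_sub_model_space]).  Hence
    everything reduces to <g f, theta> = 0.  This is where an element of the
    kernel that is nonzero at 0 enters.  Let f1 and f2 be in the kernel,
    fi = theta hi^*.  The function h2 - f2(0)^* theta is the conjugate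
    theta (f2 - f2(0))^*, so it is in K and is orthogonal to g f1, that is,
    <g f1, h2> = f2(0) <g f1, theta>.  But <g f1, h2> is the integral of
    g f1 f2 theta^*, which is symmetric in f1 and f2; therefore
    f2(0) <g f1, theta> = f1(0) <g f2, theta> ([ker_pairing_sym]).  With
    f1 = f and f2(0) <> 0 this gives <g f, theta> = 0.

    Closedness of the kernel.  Multiplication by g and the inner product are
    continuous on L^2, so the point is that K is closed, and for this that H^2
    and H^2_0 are closed in L^2 ([boundary_closed]).  A function of H^2 is
    handled through its Taylor coefficients a_k: orthogonality of the powers
    of z makes the squared norm of the dilate of radius r comparable to the
    sum of |a_k|^2 r^{2k}, and radial convergence to the boundary function
    makes the sum of |a_k|^2 comparable to the squared norm of the boundary
    function.  So L^2 convergence of boundary functions gives l^2 convergence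
    of coefficients, the limit coefficients define a power series in the disc,
    and the same comparison shows that its dilates converge to the L^2 limit.

    Only the crude inequality |x + y|^2 <= 2 (|x|^2 + |y|^2) is used to add
    norms: every estimate is about quantities tending to 0 or staying bounded,
    so the constants are immaterial. *)

Local Notation Re := complex.Re.
Local Notation Im := complex.Im.
Local Notation normc := Normc.normc.

(** * Square-integrable and integrable functions on the circle *)

Section CircleL2.
Variable R : realType.
Implicit Types (f g h theta : R -> R[i]) (z w : R[i]) (a b : nat -> R[i]).
Implicit Types (F G : R[i] -> R[i]).
Local Notation mu := (@lebesgue_measure R).
Local Notation circle := (@circle R).

Lemma complex_ReD z w : Re (z + w) = Re z + Re w. Proof. by case: z; case: w. Qed.
Lemma complex_ImD z w : Im (z + w) = Im z + Im w. Proof. by case: z; case: w. Qed.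
Lemma complex_ReB z w : Re (z - w) = Re z - Re w. Proof. by case: z; case: w. Qed.
Lemma complex_ImB z w : Im (z - w) = Im z - Im w. Proof. by case: z; case: w. Qed.
Lemma complex_ReM z w : Re (z * w) = Re z * Re w - Im z * Im w.
Proof. by case: z; case: w. Qed.
Lemma complex_ImM z w : Im (z * w) = Re z * Im w + Im z * Re w.
Proof. by case: z => a b; case: w => c d. Qed.
Lemma complex_ReJ z : Re z^*%C = Re z. Proof. by case: z. Qed.
Lemma complex_ImJ z : Im z^*%C = - Im z. Proof. by case: z. Qed.
Lemma conjcM z w : (z * w)^*%C = z^*%C * w^*%C. Proof. exact: rmorphM. Qed.
Lemma conjcN z : (- z)^*%C = - z^*%C. Proof. by case: z. Qed.
Lemma conjcB z w : (z - w)^*%C = z^*%C - w^*%C. Proof. exact: rmorphB. Qed.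
Lemma conjcD z w : (z + w)^*%C = z^*%C + w^*%C. Proof. exact: rmorphD. Qed.

Lemma sqr_normcE z : normc z ^+ 2 = Re z ^+ 2 + Im z ^+ 2.
Proof. by case: z => a b /=; rewrite sqr_sqrtr // addr_ge0 ?sqr_ge0. Qed.

Lemma normc_ge0 z : 0 <= normc z.
Proof. by case: z => a b /=; exact: sqrtr_ge0. Qed.

Lemma normr_normcE z : `|z| = (normc z)%:C.
Proof. by case: z. Qed.

Lemma normc_conj z : normc z^*%C = normc z.
Proof. by case: z => a b /=; rewrite sqrrN. Qed.

Lemma normc_mul_conj z : z * z^*%C = (normc z ^+ 2)%:C.
Proof.
rewrite sqr_normcE; apply/eqP; rewrite eq_complex; apply/andP; split; apply/eqP.
- by rewrite complex_ReM complex_ReJ complex_ImJ /=; ring.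
- by rewrite complex_ImM complex_ReJ complex_ImJ /=; ring.
Qed.

Lemma le_normr_Re z : `|Re z| <= normc z.
Proof.
rewrite -(@ler_pXn2r _ 2) ?nnegrE ?normc_ge0 //.
by rewrite real_normK ?num_real // sqr_normcE lerDl sqr_ge0.
Qed.

Lemma le_normr_Im z : `|Im z| <= normc z.
Proof.
rewrite -(@ler_pXn2r _ 2) ?nnegrE ?normc_ge0 //.
by rewrite real_normK ?num_real // sqr_normcE lerDr sqr_ge0.
Qed.

Lemma normc_le_ReIm z : normc z <= `|Re z| + `|Im z|.
Proof.
rewrite -(@ler_pXn2r _ 2) ?nnegrE ?normc_ge0 ?addr_ge0 //.
rewrite sqr_normcE sqrrD !real_normK ?num_real // -addrA lerD2l lerDr.
by rewrite mulrn_wge0// mulr_ge0.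
Qed.

Lemma normcD z w : normc (z + w) <= normc z + normc w.
Proof. exact: le_normcD. Qed.

Lemma normcB z w : normc (z - w) <= normc z + normc w.
Proof. by rewrite (le_trans (normcD _ _)) // normcN. Qed.

Lemma normcX z n : normc (z ^+ n) = normc z ^+ n.
Proof.
by elim: n => [|n IH]; [exact: Normc.normc1|rewrite !exprSr Normc.normcM IH].
Qed.

Lemma normcR (x : R) : normc x%:C = `|x|.
Proof. by rewrite /= expr0n /= addr0 sqrtr_sqr. Qed.

Lemma normc_cis (t : R) : normc (cis t) = 1.
Proof. by rewrite /= cos2Dsin2 sqrtr1. Qed.

Lemma cis_conj (t : R) : cis t * (cis t)^*%C = 1.
Proof. by rewrite normc_mul_conj normc_cis expr1n. Qed.

Lemma measurable_circleS : measurable circle.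
Proof. exact: measurable_itv. Qed.
Local Hint Resolve measurable_circleS : core.

Lemma circle_measure_lty : (mu circle < +oo)%E.
Proof.
rewrite /Defs.circle lebesgue_measure_itv.
by case: ifP => // _; rewrite -EFinD ltry.
Qed.

Lemma measurable_circleD f g : measurable_circle f -> measurable_circle g ->
  measurable_circle (fun t => f t + g t).
Proof.
move=> [f1 f2] [g1 g2]; split.
- by under eq_fun do rewrite complex_ReD; exact: measurable_funD.
- by under eq_fun do rewrite complex_ImD; exact: measurable_funD.
Qed.

Lemma measurable_circleM f g : measurable_circle f -> measurable_circle g ->
  measurable_circle (fun t => f t * g t).
Proof.
move=> [f1 f2] [g1 g2]; split.
- under eq_fun do rewrite complex_ReM.
  by apply: measurable_funB; exact: measurable_funM.
- under eq_fun do rewrite complex_ImM.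
  by apply: measurable_funD; exact: measurable_funM.
Qed.

Lemma measurable_circle_conj f : measurable_circle f ->
  measurable_circle (fun t => (f t)^*%C).
Proof.
move=> [f1 f2]; split.
- by under eq_fun do rewrite complex_ReJ.
- by under eq_fun do rewrite complex_ImJ; exact: measurableT_comp.
Qed.

Lemma measurable_circle_cst (c : R[i]) : measurable_circle (fun=> c).
Proof. by split; exact: measurable_cst. Qed.

Lemma measurable_circleN f : measurable_circle f ->
  measurable_circle (fun t => - f t).
Proof.
move=> mf; under eq_fun do rewrite -mulN1r.
exact: (measurable_circleM (measurable_circle_cst _) mf).
Qed.

Lemma measurable_circleB f g : measurable_circle f -> measurable_circle g ->
  measurable_circle (fun t => f t - g t).
Proof. by move=> mf mg; apply: measurable_circleD mf (measurable_circleN mg). Qed.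

Lemma measurable_cis : measurable_circle (@cis R).
Proof.
split; apply: measurable_funTS.
- exact: (continuous_measurable_fun (@continuous_cos R)).
- exact: (continuous_measurable_fun (@continuous_sin R)).
Qed.

Lemma measurable_normcsq f : measurable_circle f ->
  measurable_fun circle (fun t : R => (normc (f t) ^+ 2)%:E : \bar R).
Proof.
move=> [f1 f2]; apply/measurable_EFinP.
by under eq_fun do rewrite sqr_normcE; apply: measurable_funD; exact: measurable_funX.
Qed.

Lemma L2normsq_ge0 f : (0 <= L2normsq f)%E.
Proof.
rewrite /L2normsq mule_ge0 //.
  by rewrite lee_fin invr_ge0 mulr_ge0 // pi_ge0.
by apply: integral_ge0 => t _; rewrite lee_fin sqr_ge0.
Qed.

Lemma ae_circle_all (P : R -> Prop) : (forall t, circle t -> P t) -> ae_circle P.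
Proof. by move=> H; exact: aeW. Qed.

Lemma ae_circleS (P Q : R -> Prop) : (forall t, P t -> Q t) ->
  ae_circle P -> ae_circle Q.
Proof.
move=> PQ.
by apply: (@filterS _ _ (ae_filter_ringOfSetsType mu)) => t Pt /Pt/PQ.
Qed.

Lemma ae_circleS2 (P Q S : R -> Prop) : (forall t, P t -> Q t -> S t) ->
  ae_circle P -> ae_circle Q -> ae_circle S.
Proof.
move=> PQS; apply: (@filterS2 _ _ (ae_filter_ringOfSetsType mu)) => t Pt Qt ct.
by apply: PQS; [exact: Pt|exact: Qt].
Qed.

(** Covers three uses at once: multiplication by a bounded function, the
    isometry given by a unimodular function, and invariance under changes on a
    null set. *)
Lemma L2normsq_le (C : R) f h : measurable_circle f -> measurable_circle h ->
  0 <= C -> ae_circle (fun t => normc (f t) <= C * normc (h t)) ->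
  (L2normsq f <= (C ^+ 2)%:E * L2normsq h)%E.
Proof.
move=> mf mh C0 fh; rewrite /L2normsq muleCA; apply: lee_wpmul2l.
  by rewrite lee_fin invr_ge0 mulr_ge0 // pi_ge0.
rewrite -ge0_integralZl //; last 3 first.
- exact: measurable_normcsq.
- by move=> t _; rewrite lee_fin sqr_ge0.
- by rewrite lee_fin sqr_ge0.
apply: ae_ge0_le_integral => //.
- by move=> t _; rewrite lee_fin sqr_ge0.
- exact: measurable_normcsq.
- by move=> t _; rewrite -EFinM lee_fin mulr_ge0 ?sqr_ge0.
- by apply: measurable_funeM; exact: measurable_normcsq.
apply: ae_circleS fh => t fh.
rewrite -EFinM lee_fin -exprMn ler_pXn2r ?nnegrE ?normc_ge0 //.
by rewrite mulr_ge0 ?normc_ge0.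
Qed.

Lemma L2normsq_eq f h : measurable_circle f -> measurable_circle h ->
  ae_circle (fun t => normc (f t) = normc (h t)) -> L2normsq f = L2normsq h.
Proof.
move=> mf mh fh; apply/le_anti/andP; split.
  rewrite -[leRHS]mul1e -(expr1n R 2); apply: L2normsq_le => //.
  by apply: ae_circleS fh => t ->; rewrite mul1r.
rewrite -[leRHS]mul1e -(expr1n R 2); apply: L2normsq_le => //.
by apply: ae_circleS fh => t ->; rewrite mul1r.
Qed.

(** A substitute for the triangle inequality, with a pointwise domination as
    hypothesis so that it applies to sums, differences and rearranged
    combinations alike. *)
Lemma L2normsq_leD f g h : measurable_circle f -> measurable_circle g ->
  measurable_circle h ->
  (forall t, normc (h t) <= normc (f t) + normc (g t)) ->
  (L2normsq h <= 2%:E * (L2normsq f + L2normsq g))%E.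
Proof.
move=> mf mg mh hfg.
have c0 : (0 <= ((2 * pi)^-1 : R)%:E)%E by rewrite lee_fin invr_ge0 mulr_ge0 // pi_ge0.
rewrite /L2normsq -ge0_muleDr; last 2 first.
- by apply: integral_ge0 => t _; rewrite lee_fin sqr_ge0.
- by apply: integral_ge0 => t _; rewrite lee_fin sqr_ge0.
rewrite muleCA; apply: lee_wpmul2l => //.
rewrite -ge0_integralD //; last 4 first.
- by move=> t _; rewrite lee_fin sqr_ge0.
- exact: measurable_normcsq.
- by move=> t _; rewrite lee_fin sqr_ge0.
- exact: measurable_normcsq.
rewrite -ge0_integralZl //; last 2 first.
- by apply: emeasurable_funD; exact: measurable_normcsq.
- by move=> t _; rewrite -EFinD lee_fin addr_ge0 // sqr_ge0.
apply: ge0_le_integral => //.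
- by move=> t _; rewrite lee_fin sqr_ge0.
- exact: measurable_normcsq.
- by apply: measurable_funeM; apply: emeasurable_funD; exact: measurable_normcsq.
move=> t _; rewrite -EFinD -EFinM lee_fin.
apply: (@le_trans _ _ ((normc (f t) + normc (g t)) ^+ 2)).
  by rewrite ler_pXn2r ?nnegrE ?addr_ge0 ?normc_ge0.
by have := sqr_ge0 (normc (f t) - normc (g t)); nra.
Qed.

Lemma L2_measurable f : L2 f -> measurable_circle f. Proof. by case. Qed.

Lemma L2D f g : L2 f -> L2 g -> L2 (fun t => f t + g t).
Proof.
move=> [mf f1] [mg g1]; have m := measurable_circleD mf mg; split => //.
apply: le_lt_trans (L2normsq_leD mf mg m (fun t => normcD _ _)) _.
by rewrite lte_mul_pinfty // ?lte_add_pinfty.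
Qed.

Lemma L2_Linfty g f : Linfty g -> L2 f -> L2 (fun t => g t * f t).
Proof.
move=> [mg [C gC]] [mf f1]; have m := measurable_circleM mg mf; split => //.
apply: (@le_lt_trans _ _ (((Num.max C 0) ^+ 2)%:E * L2normsq f)%E).
  apply: L2normsq_le => //; first by rewrite le_max lexx orbT.
  apply: ae_circleS gC => t gC; rewrite Normc.normcM ler_wpM2r ?normc_ge0 //.
  by rewrite le_max gC.
by rewrite lte_mul_pinfty // lee_fin sqr_ge0.
Qed.

Lemma Linfty_bounded g C : measurable_circle g -> (forall t, normc (g t) <= C) ->
  Linfty g.
Proof. by move=> mg gC; split=> //; exists C; exact: ae_circle_all. Qed.

Lemma Linfty_cst (c : R[i]) : Linfty (fun=> c : R[i]).
Proof. by apply: (@Linfty_bounded _ (normc c)) => //; exact: measurable_circle_cst. Qed.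

Lemma Linfty_cis : Linfty (@cis R).
Proof. apply: (@Linfty_bounded _ 1) => [|t]; last by rewrite normc_cis.
exact: measurable_cis. Qed.

Lemma Linfty_conj g : Linfty g -> Linfty (fun t => (g t)^*%C).
Proof.
move=> [mg [C gC]]; split; first exact: measurable_circle_conj.
by exists C; apply: ae_circleS gC => t; rewrite normc_conj.
Qed.

Lemma L2Z (c : R[i]) f : L2 f -> L2 (fun t => c * f t).
Proof. exact: (L2_Linfty (Linfty_cst c)). Qed.

Lemma L2B f g : L2 f -> L2 g -> L2 (fun t => f t - g t).
Proof.
move=> f2 g2; have := L2D f2 (L2Z (-1) g2).
by under eq_fun do rewrite mulN1r.
Qed.

Lemma L2_cst (c : R[i]) : L2 (fun=> c).
Proof.
split; first exact: measurable_circle_cst.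
rewrite /L2normsq integral_cst // lte_mul_pinfty //.
  by rewrite lee_fin invr_ge0 mulr_ge0 // pi_ge0.
by rewrite lte_mul_pinfty ?lee_fin ?sqr_ge0 //; exact: circle_measure_lty.
Qed.

Lemma L2_conj f : L2 f -> L2 (fun t => (f t)^*%C).
Proof.
move=> [mf f1]; have m := measurable_circle_conj mf; split => //.
rewrite (L2normsq_eq m mf) //; apply: ae_circle_all => t _.
exact: normc_conj.
Qed.

Definition circle_integrable f :=
  mu.-integrable circle (fun t => (Re (f t))%:E) /\
  mu.-integrable circle (fun t => (Im (f t))%:E).

Lemma integrableZ_EFin (k : R) (phi : R -> R) :
  mu.-integrable circle (fun t : R => (phi t)%:E : \bar R) ->
  mu.-integrable circle (fun t : R => (k * phi t)%:E : \bar R).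
Proof.
by move=> i; under eq_fun do rewrite EFinM; exact: integrableZl.
Qed.

Lemma circle_integralD f g : circle_integrable f -> circle_integrable g ->
  circle_integral (fun t => f t + g t) = circle_integral f + circle_integral g.
Proof.
move=> [f1 f2] [g1 g2]; rewrite /circle_integral.
under eq_Rintegral do rewrite complex_ReD.
under [X in _ +i* X]eq_Rintegral do rewrite complex_ImD.
by rewrite !RintegralD.
Qed.

Lemma circle_integralZ (c : R[i]) f : circle_integrable f ->
  circle_integral (fun t => c * f t) = c * circle_integral f.
Proof.
move=> [f1 f2]; rewrite /circle_integral.
under eq_Rintegral do rewrite complex_ReM.
under [X in _ +i* X]eq_Rintegral do rewrite complex_ImM.
rewrite RintegralB ?RintegralD //.
- rewrite !RintegralZl //; first by case: c.
- exact: integrableZ_EFin.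
- exact: integrableZ_EFin.
- exact: integrableZ_EFin.
- exact: integrableZ_EFin.
Qed.

Lemma circle_integral_ae f g : measurable_circle f -> measurable_circle g ->
  ae_circle (fun t => f t = g t) -> circle_integral f = circle_integral g.
Proof.
move=> [f1 f2] [g1 g2] fg; rewrite /circle_integral /Rintegral.
congr (fine _ +i* fine _); apply: ae_eq_integral => //.
- exact/measurable_EFinP.
- exact/measurable_EFinP.
- by apply: ae_circleS fg => t ->.
- exact/measurable_EFinP.
- exact/measurable_EFinP.
- by apply: ae_circleS fg => t ->.
Qed.

Lemma L2_integrable_sq f : L2 f ->
  mu.-integrable circle (fun t : R => (normc (f t) ^+ 2)%:E : \bar R).
Proof.
move=> [mf f1]; apply/integrableP; split; first exact: measurable_normcsq.
under eq_integral do rewrite gee0_abs ?lee_fin ?sqr_ge0 //.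
move: f1; rewrite /L2normsq; set I := (\int[_]_(_ in _) _)%E.
case: I => [r| |] //; first by move=> _; rewrite ltry.
rewrite gt0_muley // lte_fin invr_gt0 mulr_gt0 // pi_gt0 //.
Qed.

(** Domination |f g| <= |f|^2 + |g|^2. *)
Lemma L2_mul_integrable f g : L2 f -> L2 g -> circle_integrable (fun t => f t * g t).
Proof.
move=> f2 g2.
have [m1 m2] := measurable_circleM (L2_measurable f2) (L2_measurable g2).
have i : mu.-integrable circle
    (fun t : R => ((normc (f t) ^+ 2)%:E + (normc (g t) ^+ 2)%:E)%E : \bar R).
  by apply: integrableD => //; exact: L2_integrable_sq.
have le t : normc (f t * g t) <= normc (f t) ^+ 2 + normc (g t) ^+ 2.
  rewrite Normc.normcM; have := sqr_ge0 (normc (f t) - normc (g t)).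
  by have := sqr_ge0 (normc (f t)); have := sqr_ge0 (normc (g t)); nra.
split.
- apply: le_integrable i => //; first exact/measurable_EFinP.
  move=> t _; rewrite -EFinD !abse_EFin lee_fin.
  rewrite (le_trans (le_normr_Re _)) // (le_trans (le t)) //.
  by rewrite ger0_norm // addr_ge0 // sqr_ge0.
- apply: le_integrable i => //; first exact/measurable_EFinP.
  move=> t _; rewrite -EFinD !abse_EFin lee_fin.
  rewrite (le_trans (le_normr_Im _)) // (le_trans (le t)) //.
  by rewrite ger0_norm // addr_ge0 // sqr_ge0.
Qed.

End CircleL2.

(** * Power series in the unit disc *)

Section PowerSeries.
Variable R : realType.
Implicit Types (f g h theta : R -> R[i]) (z w : R[i]) (a b : nat -> R[i]).
Implicit Types (F G : R[i] -> R[i]).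
Local Notation mu := (@lebesgue_measure R).
Local Notation circle := (@circle R).

(** Trades convergence in the complex numbers, whose norm is complex-valued,
    for estimates with real bounds. *)
Lemma cvg_normcP (u : nat -> R[i]) (l : R[i]) :
  (u @ \oo --> (l : R[i]^o)) <->
  (forall e : R, 0 < e -> \forall n \near \oo, normc (l - u n) < e).
Proof.
split=> [ul e e0|H].
  have e0' : 0 < e%:C :> R[i] by rewrite ltcR.
  have := (@cvgrPdist_lt _ R[i]^o _ _ _ _ _).1 ul _ e0'.
  by move=> /(_ _); apply: filterS => n; rewrite normr_normcE ltcR.
apply: (@cvgrPdist_lt _ R[i]^o _ _ _ _ _).2 => e; rewrite ltcE => /andP[/eqP /= e1 e2].
have := H _ e2; apply: filterS => n; rewrite normr_normcE ltcE /= => ->.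
by rewrite -e1 eqxx.
Qed.

Lemma normc_lt1 z : (`|z| < 1) = (normc z < 1).
Proof. by rewrite normr_normcE -(ltcR (normc z) 1). Qed.

Definition psum a (N : nat) z : R[i] := \sum_(0 <= k < N) a k * z ^+ k.

Definition disc_series a F := forall z, normc z < 1 ->
  forall e : R, 0 < e -> \forall n \near \oo, normc (F z - psum a n z) < e.

Lemma analytic_discP F : analytic_disc F <-> exists a, disc_series a F.
Proof.
split=> -[a aF]; exists a.
  by move=> z z1; apply/cvg_normcP; apply: aF; rewrite normc_lt1.
by move=> z; rewrite normc_lt1 => z1; apply/cvg_normcP; exact: aF.
Qed.

Lemma psumS a N z : psum a N.+1 z = psum a N z + a N * z ^+ N.
Proof. by rewrite /psum big_nat_recr. Qed.

Lemma psum0 a z : psum a 0 z = 0.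
Proof. by rewrite /psum big_nil. Qed.

Lemma psum_diff a N n z :
  normc (psum a (N + n) z - psum a N z) <=
  \sum_(0 <= k < n) normc (a (N + k)%N) * normc z ^+ (N + k).
Proof.
elim: n => [|n IH].
  by rewrite addn0 subrr big_nil /= expr0n /= addr0 sqrtr0.
rewrite addnS psumS big_nat_recr //= addrAC.
by rewrite (le_trans (normcD _ _)) // lerD // Normc.normcM normcX.
Qed.

(** The terms of the convergent series at the point r are bounded. *)
Lemma disc_series_coef_bound a F (r : R) : disc_series a F -> 0 <= r < 1 ->
  exists2 M : R, 0 <= M & forall n, normc (a n) * r ^+ n <= M.
Proof.
move=> aF /andP[r0 r1].
have nr : normc (r%:C : R[i]) = r by rewrite normcR ger0_norm.
have [N _ NP] := aF r%:C ltac:(by rewrite nr) 1 ltr01.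
have S0 n : 0 <= \sum_(0 <= k < n) normc (a k) * r ^+ k.
  by apply: sumr_ge0 => k _; rewrite mulr_ge0 ?normc_ge0 ?exprn_ge0.
(* beyond N all partial sums are within 1 of the limit, so terms are below 2 *)
exists (2 + \sum_(0 <= k < N) normc (a k) * r ^+ k).
  by rewrite addr_ge0.
move=> n; have [nN|Nn] := ltnP n N.
  rewrite -[leLHS]add0r lerD //.
  rewrite (big_cat_nat (n := n)) //=; last exact: ltnW.
  rewrite (@big_ltn _ _ _ n) // addrA addrAC -[leLHS]add0r lerD2r.
  rewrite addr_ge0 //; apply: sumr_ge0 => k _.
  by rewrite mulr_ge0 ?normc_ge0 ?exprn_ge0.
rewrite -[leLHS]addr0 lerD //.
have h1 := NP n Nn; have h2 := NP n.+1 (leqW Nn).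
have -> : normc (a n) * r ^+ n =
    normc ((F r%:C - psum a n r%:C) - (F r%:C - psum a n.+1 r%:C)).
  rewrite psumS -{1}nr -normcX -Normc.normcM; congr normc.
  by ring.
by rewrite (le_trans (normcB _ _)) // (_ : 2 = 1 + 1) // lerD // ltW.
Qed.

Lemma geometric_tail (q : R) N n : 0 <= q < 1 ->
  \sum_(0 <= k < n) q ^+ (N + k) <= q ^+ N / (1 - q).
Proof.
move=> /andP[q0 q1]; have q1' : 0 < 1 - q by rewrite subr_gt0.
rewrite ler_pdivlMr //.
suff -> : (\sum_(0 <= k < n) q ^+ (N + k)) * (1 - q) = q ^+ N - q ^+ (N + n).
  by rewrite gerBl exprn_ge0.
elim: n => [|n IH]; first by rewrite big_nil mul0r addn0 subrr.
by rewrite big_nat_recr //= mulrDl IH addnS exprSr; ring.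
Qed.

(** Comparison with a geometric series of ratio |z| / rho. *)
Lemma disc_series_tail a F (rho M : R) z N : disc_series a F ->
  0 < rho < 1 -> (forall n, normc (a n) * rho ^+ n <= M) -> normc z < rho ->
  normc (F z - psum a N z) <= M * (normc z / rho) ^+ N / (1 - normc z / rho).
Proof.
move=> aF /andP[r0 r1] aM zr; set q := normc z / rho.
have q01 : 0 <= q < 1.
  by rewrite divr_ge0 ?normc_ge0 ?(ltW r0) //= ltr_pdivrMr // mul1r.
have M0 : 0 <= M.
  by rewrite (le_trans _ (aM 0)) // mulr_ge0 ?normc_ge0 ?exprn_ge0 // ltW.
have zq : normc z = q * rho by rewrite /q mulfVK // gt_eqF.
apply/ler_addgt0Pr => e e0.
have [K _ KP] := aF z (lt_trans zr r1) e e0.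
have h1 := KP (N + K)%N (leq_addl _ _).
have -> : F z - psum a N z =
    (psum a (N + K) z - psum a N z) + (F z - psum a (N + K) z) by ring.
apply: le_trans (normcD _ _) _; apply: lerD; last exact: ltW.
apply: le_trans (psum_diff _ _ _ _) _.
rewrite -mulrA; apply: le_trans (ler_wpM2l M0 (geometric_tail N K q01)).
rewrite mulr_sumr; apply: ler_sum => k _.
rewrite zq exprMn mulrCA [leRHS]mulrC ler_wpM2l //.
by rewrite exprn_ge0 //; case/andP: q01.
Qed.

(** The sum is built from the real and imaginary parts separately, which
    converge absolutely by comparison with a geometric series. *)
Lemma bounded_coef_disc_series a (M : R) : (forall k, normc (a k) <= M) ->
  exists F, disc_series a F.
Proof.
move=> aM.
have M0 : 0 <= M := le_trans (normc_ge0 _) (aM 0%N).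
have key (u : nat -> R) z : normc z < 1 ->
    (forall k, `|u k| <= normc (a k * z ^+ k)) ->
    cvgn (series u).
  move=> z1 uk; apply: normed_cvg.
  apply: (@series_le_cvg _ _ (geometric M (normc z))) => //.
  - by move=> n /=; exact: normr_ge0.
  - by move=> n /=; rewrite mulr_ge0 // exprn_ge0 // normc_ge0.
  - move=> n /=; rewrite (le_trans (uk n)) // Normc.normcM normcX.
    by rewrite ler_wpM2r // exprn_ge0 // normc_ge0.
  - by apply: is_cvg_geometric_series; rewrite ger0_norm ?normc_ge0.
pose u z k := Re (a k * z ^+ k); pose v z k := Im (a k * z ^+ k).
exists (fun z => limn (series (u z)) +i* limn (series (v z))) => z z1 e e0.
have /cvgrPdist_lt cu := key (u z) z z1 (fun k => le_normr_Re _).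
have /cvgrPdist_lt cv := key (v z) z z1 (fun k => le_normr_Im _).
have e2 : 0 < e / 2 by rewrite divr_gt0.
have := cu _ e2; have := cv _ e2; apply: filterS2 => n h1 h2.
rewrite (le_lt_trans (normc_le_ReIm _)) // [ltRHS](splitr e).
have -> : psum a n z = series (u z) n +i* series (v z) n.
  rewrite /series /psum /=; elim: n {h1 h2} => [|n IH]; first by rewrite !big_nil.
  by rewrite !big_nat_recr //= IH /u /v; case: (a n * z ^+ n).
by rewrite ltrD.
Qed.

Lemma disc_series0 a F : disc_series a F -> F 0 = a 0%N.
Proof.
move=> aF; apply/eqP; rewrite -subr_eq0; apply/eqP/Normc.eq0_normc.
apply/eqP; rewrite eq_le normc_ge0 andbT; apply/ler_addgt0Pr => e e0.
have z1 : normc (0 : R[i]) < 1 by rewrite Normc.normc0.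
have [N _ NP] := aF 0 z1 e e0; have := NP N.+1 (leqnSn _).
have -> : psum a N.+1 0 = a 0%N.
  rewrite /psum big_nat_recl //= expr0 mulr1 big1 ?addr0 // => i _.
  by rewrite expr0n mulr0.
by rewrite add0r => /ltW.
Qed.

Lemma disc_series_cst (c : R[i]) :
  disc_series (fun n => if n is 0 then c else 0) (fun=> c).
Proof.
move=> z z1 e e0; exists 1%N => // n /= n0.
suff -> : psum (fun n => if n is 0 then c else 0) n z = c.
  by rewrite subrr Normc.normc0.
case: n n0 => // n _.
rewrite /psum big_nat_recl //= expr0 mulr1 big1 ?addr0 // => i _.
by rewrite mul0r.
Qed.

Lemma disc_seriesD a b F G : disc_series a F -> disc_series b G ->
  disc_series (fun n => a n + b n) (fun z => F z + G z).
Proof.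
move=> aF bG z z1 e e0; have e2 : 0 < e / 2 by rewrite divr_gt0.
have := aF z z1 _ e2; have := bG z z1 _ e2; apply: filterS2 => n h1 h2.
have -> : F z + G z - psum (fun n => a n + b n) n z =
    (F z - psum a n z) + (G z - psum b n z).
  rewrite /psum addrACA -opprD -big_split /=; congr (_ - _).
  by apply: eq_bigr => k _; rewrite mulrDl.
by rewrite (le_lt_trans (normcD _ _)) // (splitr e) ltrD.
Qed.

Lemma disc_seriesZ a (c : R[i]) F : disc_series a F ->
  disc_series (fun n => c * a n) (fun z => c * F z).
Proof.
move=> aF z z1 e e0.
have c0 : 0 < normc c + 1 by rewrite ltr_wpDl // normc_ge0.
have e2 : 0 < e / (normc c + 1) by rewrite divr_gt0.
have := aF z z1 _ e2; apply: filterS => n h1.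
have -> : c * F z - psum (fun n => c * a n) n z = c * (F z - psum a n z).
  rewrite mulrBr /psum mulr_sumr; congr (_ - _).
  by apply: eq_bigr => k _; rewrite mulrA.
rewrite Normc.normcM.
rewrite (@le_lt_trans _ _ ((normc c + 1) * normc (F z - psum a n z))) //.
  by rewrite ler_wpM2r ?normc_ge0 // lerDl.
by rewrite mulrC -ltr_pdivlMr.
Qed.

Lemma disc_series_mulX a F : disc_series a F ->
  disc_series (fun n => if n is m.+1 then a m else 0) (fun z => z * F z).
Proof.
move=> aF z z1 e e0.
have [N _ NP] := aF z z1 e e0; exists N.+1 => // n /= Nn.
case: n Nn => // n Nn; have := NP n Nn.
have -> : psum (fun n => if n is m.+1 then a m else 0) n.+1 z = z * psum a n z.
  rewrite /psum big_nat_recl //= mul0r add0r mulr_sumr.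
  by apply: eq_bigr => k _; rewrite exprS mulrCA.
rewrite -mulrBr Normc.normcM; apply: le_lt_trans.
by rewrite ler_piMl ?normc_ge0 // ltW.
Qed.

(** Phrased for any G that fills the singularity at 0 with the coefficient
    a_1, because the value of the backward shift there is a derivative that is
    computed from this very lemma. *)
Lemma disc_series_div a F G : disc_series a F -> G 0 = a 1%N ->
  (forall z, z != 0 -> G z = (F z - F 0) / z) ->
  disc_series (fun n => a n.+1) G.
Proof.
move=> aF G0 Gz z z1 e e0; have [->|z0] := eqVneq z 0.
  exists 1%N => // -[|n] //= _.
  rewrite G0 /psum big_nat_recl //= expr0 mulr1 big1 ?addr0 ?subrr ?Normc.normc0 //.
  by move=> i _; rewrite expr0n mulr0.
have nz : 0 < normc z.
  by rewrite lt_neqAle normc_ge0 andbT eq_sym; apply/contra_neq: z0 => /Normc.eq0_normc.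
have e2 : 0 < e * normc z by rewrite mulr_gt0.
have [N _ NP] := aF z z1 _ e2; exists N => // n Nn.
have := NP n.+1 (leqW Nn).
have -> : F z - psum a n.+1 z = (G z - psum (fun n => a n.+1) n z) * z.
  rewrite Gz // mulrBl divfK // (disc_series0 aF) /psum big_nat_recl //=.
  rewrite expr0 mulr1 opprD addrA; congr (_ - _); rewrite mulr_suml.
  by apply: eq_bigr => k _; rewrite exprSr mulrA.
by rewrite Normc.normcM ltr_pM2r.
Qed.

(** The difference quotient at 0 is itself a power series with constant term
    a_1, so its distance to a_1 is bounded by the tail of that series. *)
Lemma disc_series_derive a F : disc_series a F ->
  derive1 (F : R[i]^o -> R[i]^o) 0 = a 1%N.
Proof.
move=> aF; rewrite /derive1.
pose G z := if z == 0 then a 1%N else (F z - F 0) / z.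
have bG : disc_series (fun n => a n.+1) G.
  by apply: (disc_series_div aF); rewrite /G ?eqxx // => z /negPf ->.
apply: cvg_lim; first exact: norm_hausdorff.
have [|M M0 MP] := disc_series_coef_bound (r := 1/2) bG; first by lra.
apply/cvgrPdist_lt => e; rewrite ltcE => /andP[/eqP /= e1 e2].
(* for |h| < 1/4 the tail bound at radius 1/2 is at most 4 M |h| *)
pose d : R := Num.min (1/4) (complex.Re e / (4 * (M + 1))).
have d0 : 0 < d.
  by rewrite lt_min; apply/andP; split; rewrite ?divr_gt0 ?mulr_gt0 //; lra.
exists d%:C => /=; first by rewrite ltcR.
move=> h /=; rewrite sub0r normrN normr_normcE ltcR => hd h0.
rewrite addr0 normr_normcE ltcE /= -e1 eqxx /=.
have -> : h^-1 *: (F h - F 0) = G h by rewrite /G (negPf h0) mulrC.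
have hn := normc_ge0 h.
have [hd1 hd2] : normc h < 1/4 /\ normc h < complex.Re e / (4 * (M + 1)).
  by move: hd; rewrite lt_min => /andP[].
rewrite -normcN opprB.
have T := disc_series_tail 1 bG (rho := 1/2) ltac:(lra) MP (z := h) ltac:(lra).
have p1 : psum (fun n => a n.+1) 1 h = a 1%N.
  by rewrite /psum big_nat1 expr0 mulr1.
move: T; rewrite p1 => /le_lt_trans; apply.
rewrite expr1 ltr_pdivrMr; last lra.
move: hd2; rewrite ltr_pdivlMr; last lra.
by set q := normc h in hn hd1 *; set E := complex.Re e in e2 *; nra.
Qed.

End PowerSeries.

(** * The inner product of L^2 and the orthogonality of the powers of z *)

Section InnerProduct.
Variable R : realType.
Implicit Types (f g h theta : R -> R[i]) (z w : R[i]) (a b : nat -> R[i]).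
Implicit Types (F G : R[i] -> R[i]).
Local Notation mu := (@lebesgue_measure R).
Local Notation circle := (@circle R).

Lemma twopi_gt0 : 0 < 2 * pi :> R.
Proof. by rewrite mulr_gt0 // pi_gt0. Qed.

Lemma L2_mul_conj_integrable f g : L2 f -> L2 g ->
  circle_integrable (fun t => f t * (g t)^*%C).
Proof. by move=> f2 g2; apply: L2_mul_integrable f2 (L2_conj g2). Qed.

Lemma L2innerDl f g h : L2 f -> L2 g -> L2 h ->
  L2inner (fun t => f t + g t) h = L2inner f h + L2inner g h.
Proof.
move=> f2 g2 h2; rewrite /L2inner -mulrDr -circle_integralD.
- by congr (_ * circle_integral _); apply/funext => t; rewrite mulrDl.
- exact: L2_mul_conj_integrable.
- exact: L2_mul_conj_integrable.
Qed.

Lemma L2innerDr f g h : L2 f -> L2 g -> L2 h ->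
  L2inner f (fun t => g t + h t) = L2inner f g + L2inner f h.
Proof.
move=> f2 g2 h2; rewrite /L2inner -mulrDr -circle_integralD.
- by congr (_ * circle_integral _); apply/funext => t; rewrite conjcD mulrDr.
- exact: L2_mul_conj_integrable.
- exact: L2_mul_conj_integrable.
Qed.

Lemma L2innerZl (c : R[i]) f h : L2 f -> L2 h ->
  L2inner (fun t => c * f t) h = c * L2inner f h.
Proof.
move=> f2 h2; rewrite /L2inner mulrCA; congr (_ * _); rewrite -circle_integralZ.
- by congr circle_integral; apply/funext => t; rewrite mulrA.
- exact: L2_mul_conj_integrable.
Qed.

Lemma L2innerZr (c : R[i]) f h : L2 f -> L2 h ->
  L2inner f (fun t => c * h t) = c^*%C * L2inner f h.
Proof.
move=> f2 h2; rewrite /L2inner mulrCA; congr (_ * _); rewrite -circle_integralZ.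
- by congr circle_integral; apply/funext => t; rewrite conjcM mulrCA.
- exact: L2_mul_conj_integrable.
Qed.

Lemma circle_integral_conj f : circle_integrable f ->
  circle_integral (fun t => (f t)^*%C) = (circle_integral f)^*%C.
Proof.
move=> [f1 f2]; rewrite /circle_integral /=; congr (_ +i* _).
  by apply: eq_Rintegral => t _; rewrite complex_ReJ.
rewrite -mulN1r -RintegralZl //.
  by apply: eq_Rintegral => t _; rewrite complex_ImJ mulN1r.
exact: measurable_circleS.
Qed.

Lemma L2inner_conj f g : L2 f -> L2 g -> L2inner g f = (L2inner f g)^*%C.
Proof.
move=> f2 g2; rewrite /L2inner [RHS]rmorphM /= oppr0; congr (_ * _).
rewrite -[LHS]conjcK -[RHS]/((circle_integral _)^*%C).
rewrite -circle_integral_conj; last exact: L2_mul_conj_integrable.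
by rewrite conjcK; congr circle_integral; apply/funext => t; rewrite conjcM conjcK mulrC.
Qed.

Lemma L2normsq_inner f : L2 f -> L2normsq f = (Re (L2inner f f))%:E.
Proof.
move=> f2; rewrite /L2inner /L2normsq complex_ReM /= mul0r subr0 EFinM; congr (_ * _)%E.
rewrite /Rintegral fineK.
  by apply: eq_integral => t _; rewrite normc_mul_conj.
apply: integrable_fin_num; first exact: measurable_circleS.
by have [] := L2_mul_conj_integrable f2 f2.
Qed.

(** Pythagoras. *)
Lemma L2normsqD_orth f g : L2 f -> L2 g -> L2inner f g = 0 ->
  L2normsq (fun t => f t + g t) = (L2normsq f + L2normsq g)%E.
Proof.
move=> f2 g2 fg0; have fg2 := L2D f2 g2.
rewrite !L2normsq_inner // L2innerDl // !L2innerDr // (L2inner_conj f2 g2) fg0.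
by rewrite conjc0 add0r addr0 complex_ReD.
Qed.

Lemma cisD (s t : R) : cis (s + t) = cis s * cis t.
Proof. by rewrite /cis cosD sinD; congr (_ +i* _); rewrite addrC. Qed.

Lemma cisMn n (t : R) : cis (n%:R * t) = cis t ^+ n.
Proof.
elim: n => [|n IH]; first by rewrite mul0r expr0 /cis cos0 sin0.
by rewrite -natr1 mulrDl mul1r cisD IH exprSr.
Qed.

Lemma cis2pi : cis (2 * pi) = 1 :> R[i].
Proof. by rewrite /cis mulr_natl cos2pi sin2pi. Qed.

(** Fundamental theorem of calculus over a full period. *)
Lemma Rintegral_periodic_derive (phi Phi : R -> R) :
  (forall x : R, is_derive (x : R^o) 1 (Phi : R^o -> R^o) (phi x)) -> continuous phi ->
  Phi (2 * pi) = Phi 0 -> Rintegral mu circle phi = 0.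
Proof.
move=> dPhi cphi per; rewrite /Rintegral /Defs.circle.
have cPhi : continuous Phi.
  move=> x; apply/differentiable_continuous/derivable1_diffP.
  by have [] := dPhi x.
rewrite (continuous_FTC2 (F := Phi) twopi_gt0).
- by rewrite per -EFinB subrr.
- exact: continuous_subspaceT.
- split.
  + by move=> x _; have [] := dPhi x.
  + exact/cvg_at_right_filter/cPhi.
  + exact/cvg_at_left_filter/cPhi.
- by move=> x _; rewrite derive1E; have [] := dPhi x.
Qed.

Lemma circle_integral_cisX n : circle_integral (fun t : R => cis t ^+ n.+1) = 0.
Proof.
under [X in circle_integral X]funext do rewrite -cisMn.
have c0 : (n.+1%:R : R) != 0 by rewrite pnatr_eq0.
have cont : continuous (fun x : R => n.+1%:R * x).
  by move=> x; apply: cvgM; [exact: cvg_cst|exact: cvg_id].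
rewrite /circle_integral /=; apply/eqP; rewrite eq_complex /=.
apply/andP; split; apply/eqP.
- apply: (@Rintegral_periodic_derive _ (fun x => n.+1%:R^-1 * sin (n.+1%:R * x))).
  + move=> x; apply: is_derive_eq; by rewrite /GRing.scale /=; field.
  + by move=> x; apply: continuous_comp; [exact: cont|exact: continuous_cos].
  + have := cisMn n.+1 (2 * pi); rewrite cis2pi expr1n => -[_ ->].
    by rewrite !mulr0 sin0 mulr0.
- apply: (@Rintegral_periodic_derive _ (fun x => - n.+1%:R^-1 * cos (n.+1%:R * x))).
  + move=> x; apply: is_derive_eq; by rewrite /GRing.scale /=; field.
  + by move=> x; apply: continuous_comp; [exact: cont|exact: continuous_sin].
  + have := cisMn n.+1 (2 * pi); rewrite cis2pi expr1n => -[-> _].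
    by rewrite mulr0 cos0.
Qed.

Lemma L2_cisX n : L2 (fun t : R => cis t ^+ n).
Proof.
elim: n => [|n IH]; first exact: L2_cst.
by under [X in L2 X]funext do rewrite exprS; exact: L2_Linfty (@Linfty_cis R) IH.
Qed.

(** The product of z^k and (z^j)^* is the positive power z^(k-j), which has
    mean zero. *)
Lemma L2inner_cisX j k : (j < k)%N ->
  L2inner (fun t : R => cis t ^+ k) (fun t : R => cis t ^+ j) = 0.
Proof.
move=> jk; rewrite /L2inner.
have -> : (fun t : R => cis t ^+ k * (cis t ^+ j)^*%C) =
    (fun t : R => cis t ^+ (k - j).-1.+1).
  apply/funext => t; rewrite prednK ?subn_gt0 // -[in LHS](subnK (ltnW jk)).
  by rewrite exprD rmorphXn -mulrA -exprMn cis_conj expr1n mulr1.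
by rewrite circle_integral_cisX mulr0.
Qed.

Lemma L2normsq_cst (c : R[i]) : L2normsq (fun=> c) = (normc c ^+ 2)%:E.
Proof.
rewrite /L2normsq integral_cst; last exact: measurable_circleS.
rewrite /Defs.circle; have := @lebesgue_measure_itv R `[0, 2 * pi].
rewrite /= lte_fin twopi_gt0 sube0 => ->; rewrite -!EFinM mulrCA mulVf ?mulr1 //.
by rewrite gt_eqF // twopi_gt0.
Qed.

Lemma L2normsq_bounded f (e : R) : measurable_circle f ->
  (forall t, normc (f t) <= e) -> (L2normsq f <= (e ^+ 2)%:E)%E.
Proof.
move=> mf fe; have -> : (e ^+ 2)%:E = ((e ^+ 2)%:E * L2normsq (fun=> (1 : R[i])%R))%E.
  by rewrite L2normsq_cst Normc.normc1 expr1n mule1.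
apply: L2normsq_le => //.
- exact: le_trans (normc_ge0 _) (fe 0).
- by apply: ae_circle_all => t _; rewrite Normc.normc1 mulr1.
Qed.

Lemma L2_psum_circle a N (r : R) : L2 (fun t => psum a N (r%:C * cis t)).
Proof.
elim: N => [|N IH].
  by under [X in L2 X]funext do rewrite psum0; exact: L2_cst.
under [X in L2 X]funext do rewrite psumS exprMn mulrA.
by apply: L2D IH _; exact/L2Z/L2_cisX.
Qed.

Lemma L2normsqZ (c : R[i]) f : L2 f ->
  L2normsq (fun t => c * f t) = ((normc c ^+ 2)%:E * L2normsq f)%E.
Proof.
move=> f2; rewrite !L2normsq_inner ?L2innerZl ?L2innerZr //; try exact: L2Z.
rewrite mulrA normc_mul_conj complex_ReM [Im _]/= mul0r subr0 [Re _%:C]/= EFinM //.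
Qed.

(** Parseval for polynomials, by induction on the number of terms: each new
    monomial is orthogonal to the previous partial sum. *)
Lemma L2normsq_psum a N (r : R) : L2normsq (fun t => psum a N (r%:C * cis t)) =
  (\sum_(0 <= k < N) normc (a k) ^+ 2 * r ^+ (2 * k))%:E.
Proof.
elim: N => [|N IH].
  under [X in L2normsq X]funext do rewrite psum0.
  by rewrite big_nil L2normsq_cst Normc.normc0 expr0n.
under [X in L2normsq X]funext do rewrite psumS exprMn mulrA.
have cN2 := L2_cisX N.
rewrite L2normsqD_orth.
- rewrite IH L2normsqZ //.
  have -> : L2normsq (fun t : R => cis t ^+ N) = 1%E.
    rewrite -[RHS](_ : L2normsq (fun=> 1 : R[i]) = _).
      apply: L2normsq_eq.
      + exact: L2_measurable.
      + exact: measurable_circle_cst.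
      + by apply: ae_circle_all => t _; rewrite normcX normc_cis expr1n Normc.normc1.
    by rewrite L2normsq_cst Normc.normc1 expr1n.
  rewrite mule1 -EFinD big_nat_recr //= Normc.normcM exprMn normcX normcR.
  by rewrite -exprM mulnC exprM real_normK ?num_real // -exprM.
- exact: L2_psum_circle.
- exact: L2Z.
- rewrite L2innerZr //; last exact: L2_psum_circle.
  suff : forall M, (M <= N)%N -> L2inner (fun t => psum a M (r%:C * cis t))
      (fun t : R => cis t ^+ N) = 0.
    by move=> /(_ _ (leqnn N)) ->; rewrite mulr0.
  elim=> [|M IHM] MN.
    under [X in L2inner X]funext do rewrite psum0 -(mul0r 0).
    by rewrite L2innerZl ?mul0r //; exact: L2_cst.
  under [X in L2inner X]funext do rewrite psumS exprMn mulrA.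
  rewrite L2innerDl ?IHM ?(ltnW MN) ?add0r //; last 2 first.
  + exact: L2_psum_circle.
  + exact/L2Z/L2_cisX.
  rewrite L2innerZl //; last exact: L2_cisX.
  by rewrite (L2inner_conj cN2) ?L2inner_cisX ?conjc0 ?mulr0 //; exact: L2_cisX.
Qed.

End InnerProduct.

(** * Taylor coefficients and boundary functions *)

Section RadialLimits.
Variable R : realType.
Implicit Types (f g h theta : R -> R[i]) (z w : R[i]) (a b : nat -> R[i]).
Implicit Types (F G : R[i] -> R[i]).
Local Notation mu := (@lebesgue_measure R).
Local Notation circle := (@circle R).

(** The squared L^2 norm as a real number, so that estimates become linear
    arithmetic; it is meaningful for functions in L^2. *)
Definition energy f : R := fine (L2normsq f).

Lemma L2normsq_energy f : L2 f -> L2normsq f = (energy f)%:E.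
Proof. by move=> [_ f1]; rewrite fineK // ge0_fin_numE // L2normsq_ge0. Qed.

Lemma energy_ge0 f : 0 <= energy f.
Proof. by rewrite fine_ge0 // L2normsq_ge0. Qed.

Lemma energy_leD f g h : L2 f -> L2 g -> L2 h ->
  (forall t, normc (h t) <= normc (f t) + normc (g t)) ->
  energy h <= 2 * (energy f + energy g).
Proof.
move=> f2 g2 h2 hfg.
have := L2normsq_leD (L2_measurable f2) (L2_measurable g2) (L2_measurable h2) hfg.
by rewrite !L2normsq_energy.
Qed.

Lemma energyD f g : L2 f -> L2 g ->
  energy (fun t => f t + g t) <= 2 * (energy f + energy g).
Proof.
move=> f2 g2; apply: energy_leD => //; first exact: L2D.
by move=> t; exact: normcD.
Qed.

Lemma energyB f g : L2 f -> L2 g ->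
  energy (fun t => f t - g t) <= 2 * (energy f + energy g).
Proof.
move=> f2 g2; apply: energy_leD => //; first exact: L2B.
by move=> t; exact: normcB.
Qed.

Lemma energyZ (c : R[i]) f : L2 f ->
  energy (fun t => c * f t) = normc c ^+ 2 * energy f.
Proof.
move=> f2; have := L2normsqZ c f2.
by rewrite (L2normsq_energy f2) (L2normsq_energy (L2Z c f2)) -EFinM => -[].
Qed.

Lemma energy_bounded f (e : R) : L2 f -> (forall t, normc (f t) <= e) ->
  energy f <= e ^+ 2.
Proof.
move=> f2 fe; have := L2normsq_bounded (L2_measurable f2) fe.
by rewrite L2normsq_energy.
Qed.

Lemma energy_psum a N (r : R) : energy (fun t => psum a N (r%:C * cis t)) =
  \sum_(0 <= k < N) normc (a k) ^+ 2 * r ^+ (2 * k).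
Proof. by rewrite /energy L2normsq_psum. Qed.

Lemma L2normsq_cvg0P (T : Type) (FF : set_system T) (u : T -> R -> R[i]) :
  Filter FF ->
  (L2normsq (u x) @[x --> FF] --> 0%E) <->
  (forall e : R, 0 < e -> \forall x \near FF, (L2normsq (u x) < e%:E)%E).
Proof.
move=> F0; split.
  move=> /fine_cvgP[fin /cvgrPdist_lt H] e e0; have := H e e0.
  apply: filterS2 fin => x fin; rewrite /= sub0r normrN ger0_norm.
    by rewrite -lte_fin fineK.
  by rewrite fine_ge0 // L2normsq_ge0.
move=> H; apply/fine_cvgP; split.
  have := H 1 ltr01; apply: filterS => x h.
  by rewrite ge0_fin_numE ?L2normsq_ge0 // (lt_trans h) // ltry.
apply/cvgrPdist_lt => e e0; have := H e e0; apply: filterS => x h /=.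
rewrite sub0r normrN ger0_norm ?fine_ge0 ?L2normsq_ge0 // -lte_fin fineK //.
by rewrite ge0_fin_numE ?L2normsq_ge0 // (lt_trans h) // ltry.
Qed.

Lemma normc_dilate_arg (r t : R) : 0 <= r -> normc (r%:C * cis t) = r.
Proof. by move=> r0; rewrite Normc.normcM normc_cis mulr1 normcR ger0_norm. Qed.

(** On the circle of radius r the tail estimate, taken with an intermediate
    radius (1 + r) / 2, is uniform in the angle. *)
Lemma dilate_psum_uniform a F (r e : R) : disc_series a F -> 0 <= r < 1 -> 0 < e ->
  \forall n \near \oo, forall t, normc (F (r%:C * cis t) - psum a n (r%:C * cis t)) < e.
Proof.
move=> aF /andP[r0 r1] e0; pose rho := (1 + r) / 2.
have rho01 : 0 < rho < 1 by rewrite /rho; apply/andP; split; lra.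
have rrho : r < rho by rewrite /rho; lra.
have [|M M0 aM] := disc_series_coef_bound (r := rho) aF.
  by case/andP: rho01 => /ltW -> ->.
pose q := r / rho.
have q0 : 0 <= q by rewrite divr_ge0 // ltW //; case/andP: rho01.
have q1 : q < 1 by rewrite ltr_pdivrMr ?mul1r //; case/andP: rho01.
have : (fun n => M / (1 - q) * q ^+ n) @ \oo --> M / (1 - q) * 0.
  by apply: cvgM; [exact: cvg_cst|apply: cvg_expr; rewrite ger0_norm].
rewrite mulr0 => /cvgrPdist_lt /(_ e e0); apply: filterS => n.
rewrite sub0r normrN ger0_norm; last first.
  by rewrite mulr_ge0 ?exprn_ge0 // divr_ge0 // subr_ge0 ltW.
move=> h t; apply: le_lt_trans h.
have zr := normc_dilate_arg t r0.
have := disc_series_tail n aF rho01 aM (z := r%:C * cis t).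
by rewrite zr mulrAC; apply.
Qed.

Lemma measurable_dilate a F (r : R) : disc_series a F -> 0 <= r < 1 ->
  measurable_circle (dilate F r).
Proof.
move=> aF r01; have mp n := L2_measurable (L2_psum_circle a n r).
have H t e (e0 : 0 < e) : \forall n \near \oo,
    normc (F (r%:C * cis t) - psum a n (r%:C * cis t)) < e.
  by have := dilate_psum_uniform aF r01 e0; apply: filterS => n; exact.
split.
- apply: (@measurable_fun_cvg _ _ _ _ (fun n t => Re (psum a n (r%:C * cis t)))).
    by move=> n; case: (mp n).
  move=> t _; apply/cvgrPdist_lt => e e0; have := H t e e0.
  apply: filterS => n; apply: le_lt_trans.
  by rewrite -complex_ReB; exact: le_normr_Re.
- apply: (@measurable_fun_cvg _ _ _ _ (fun n t => Im (psum a n (r%:C * cis t)))).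
    by move=> n; case: (mp n).
  move=> t _; apply/cvgrPdist_lt => e e0; have := H t e e0.
  apply: filterS => n; apply: le_lt_trans.
  by rewrite -complex_ImB; exact: le_normr_Im.
Qed.

Lemma dilate_psum_approx a F (r e : R) : disc_series a F -> 0 <= r < 1 -> 0 < e ->
  \forall n \near \oo, L2 (fun t => dilate F r t - psum a n (r%:C * cis t)) /\
    energy (fun t => dilate F r t - psum a n (r%:C * cis t)) <= e.
Proof.
move=> aF r01 e0.
(* a uniform bound at most 1 and at most e squares to at most e *)
have m0 : 0 < Num.min 1 e by rewrite lt_min ltr01.
have := dilate_psum_uniform aF r01 m0; apply: filterS => n h.
have m := measurable_circleB (measurable_dilate aF r01)
  (L2_measurable (L2_psum_circle a n r)).
have hle t : normc (dilate F r t - psum a n (r%:C * cis t)) <= Num.min 1 e.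
  exact: ltW (h t).
have l2 : L2 (fun t => dilate F r t - psum a n (r%:C * cis t)).
  by split=> //; rewrite (le_lt_trans (L2normsq_bounded m hle)) // ltry.
split => //; apply: le_trans (energy_bounded l2 hle) _.
have h1 : Num.min 1 e <= 1 by rewrite ge_min lexx.
have h2 : Num.min 1 e <= e by rewrite ge_min lexx orbT.
by apply: le_trans h2; rewrite expr2 ger_pMr.
Qed.

Lemma L2_dilate a F (r : R) : disc_series a F -> 0 <= r < 1 -> L2 (dilate F r).
Proof.
move=> aF r01; have [n _ /(_ n (leqnn n)) [h _]] := dilate_psum_approx aF r01 ltr01.
have := L2D h (L2_psum_circle a n r).
by under [X in L2 X -> _]funext do rewrite subrK.
Qed.

(** With [energy_dilate_le_coef] this is Parseval for a dilate, up to a factor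
    2 that comes from approximating the dilate by partial sums. *)
Lemma coef_le_energy_dilate a F (r : R) N : disc_series a F -> 0 <= r < 1 ->
  \sum_(0 <= k < N) normc (a k) ^+ 2 * r ^+ (2 * k) <= 2 * energy (dilate F r).
Proof.
move=> aF r01; have /andP[r0 r1] := r01.
apply/ler_addgt0Pr => e e0; have e2 : 0 < e / 2 by rewrite divr_gt0.
have [n0 _ nP] := dilate_psum_approx aF r01 e2.
pose n := (N + n0)%N; have [h1 h2] := nP n (leq_addl _ _).
apply: (@le_trans _ _ (energy (fun t => psum a n (r%:C * cis t)))).
  rewrite energy_psum (big_cat_nat (n := N) (p := n)) ?leq_addr //= lerDl.
  by apply: sumr_ge0 => k _; rewrite mulr_ge0 ?sqr_ge0 ?exprn_ge0.
apply: (@le_trans _ _ (2 * (energy (dilate F r) + e / 2))); last lra.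
apply: le_trans (energy_leD (L2_dilate aF r01) h1 (L2_psum_circle a n r) _) _.
  move=> t; have := normcB (dilate F r t) (dilate F r t - psum a n (r%:C * cis t)).
  by rewrite opprB addrC subrK.
by rewrite ler_pM2l // lerD2l.
Qed.

Lemma energy_dilate_le_coef a F (r C : R) : disc_series a F -> 0 <= r < 1 ->
  (forall N, \sum_(0 <= k < N) normc (a k) ^+ 2 <= C) ->
  energy (dilate F r) <= 2 * C.
Proof.
move=> aF r01 aC; have /andP[r0 r1] := r01.
apply/ler_addgt0Pr => e e0; have e2 : 0 < e / 2 by rewrite divr_gt0.
have [n _ /(_ n (leqnn n)) [h1 h2]] := dilate_psum_approx aF r01 e2.
apply: le_trans (energy_leD (L2_psum_circle a n r) h1 (L2_dilate aF r01) _) _.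
  move=> t; have := normcD (psum a n (r%:C * cis t))
    (dilate F r t - psum a n (r%:C * cis t)).
  by rewrite addrC subrK.
have : energy (fun t => psum a n (r%:C * cis t)) <= C.
  rewrite energy_psum; apply: le_trans (aC n); apply: ler_sum => k _.
  by rewrite ler_piMr ?sqr_ge0 // exprn_ile1 // ltW.
lra.
Qed.

Lemma near_left1_in01 : \forall r \near (1 : R)^'-, 0 < r < 1.
Proof.
apply: filterS2 (nbhs_left_lt 1) (nbhs_left_gt (ltr01 : (0 : R) < 1)) => r h1 h2.
by rewrite h2 h1.
Qed.

(** Lets r tend to 1 in a bound that carries a fixed power of r. *)
Lemma near_left1_exp_le (S B : R) m :
  (\forall r \near (1 : R)^'-, S * r ^+ m <= B) -> S <= B.
Proof.
move=> H; apply/ler_addgt0Pr => e e0.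
have c : (fun r : R => S * r ^+ m) r @[r --> 1^'-] --> S * 1 ^+ m.
  apply: cvgM; first exact: cvg_cst.
  by apply: cvg_at_left_filter; exact: exprn_continuous.
move: c; rewrite expr1n mulr1 => /cvgrPdist_lt /(_ e e0) H2.
have [r /= [h1 h2]] := filter_ex (filterI H H2).
by have := ler_norm (S - S * r ^+ m); lra.
Qed.

(** Boundary values together with a choice of Taylor coefficients.  These
    conditions imply the uniform bound on the norms of the dilates that defines
    H^2: see [boundaryP]. *)
Definition radial_limit a F f :=
  [/\ disc_series a F, L2 f & forall e : R, 0 < e ->
    \forall r \near (1 : R)^'-, energy (fun t => dilate F r t - f t) < e].

(** The coefficients are bounded through dilates close to the boundary, whose
    norm is close to that of f; the factor r^(2N) is removed at the end by
    letting r tend to 1. *)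
Lemma coef_le_energy a F f N : radial_limit a F f ->
  \sum_(0 <= k < N) normc (a k) ^+ 2 <= 4 * energy f.
Proof.
move=> [aF f2 cf]; apply/ler_addgt0Pr => e e0.
have e4 : 0 < e / 4 by rewrite divr_gt0.
(* r^(2N) is a lower bound for all the weights r^(2k) with k < N *)
apply: (@near_left1_exp_le _ _ (2 * N)).
have := cf _ e4; apply: filterS2 near_left1_in01 => r /andP[r0 r1] h.
have r01 : 0 <= r < 1 by rewrite ltW.
apply: (@le_trans _ _ (2 * energy (dilate F r))).
  apply: le_trans (coef_le_energy_dilate N aF r01).
  rewrite mulr_suml big_nat [leRHS]big_nat; apply: ler_sum => k /andP[_ kN].
  rewrite ler_wpM2l ?sqr_ge0 // ler_wiXn2l ?ltW //.
  by rewrite leq_mul2l ltnW // orbT.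
have d2 := L2_dilate aF r01.
have : energy (dilate F r) <= 2 * (energy f + energy (fun t => dilate F r t - f t)).
  apply: energy_leD => //; first exact: L2B.
  by move=> t; have := normcD (f t) (dilate F r t - f t); rewrite addrC subrK.
lra.
Qed.

(** The bound on all dilates comes from the l^2 bound on the coefficients,
    which in turn comes from the dilates near the boundary. *)
Lemma boundaryP F f : boundary F f <-> exists a, radial_limit a F f.
Proof.
split=> [[[/analytic_discP[a aF] _] f2 cf]|[a [aF f2 cf]]].
  exists a; split => // e e0.
  have /L2normsq_cvg0P cf' := cf; have := cf' e e0.
  apply: filterS2 near_left1_in01 => r /andP[r0 r1].
  have d2 : L2 (dilate F r) by apply: (L2_dilate aF); rewrite ltW.
  by rewrite L2normsq_energy ?lte_fin //; exact: L2B.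
have H : radial_limit a F f by split.
split => //.
- split; first by apply/analytic_discP; exists a.
  exists (2 * (4 * energy f)) => r r01.
  rewrite L2normsq_energy; last exact: L2_dilate aF r01.
  rewrite lee_fin; apply: energy_dilate_le_coef aF r01 _ => N.
  exact: coef_le_energy H.
- apply/L2normsq_cvg0P => e e0; have := cf e e0.
  apply: filterS2 near_left1_in01 => r /andP[r0 r1].
  have d2 : L2 (dilate F r) by apply: (L2_dilate aF); rewrite ltW.
  by rewrite -lte_fin -L2normsq_energy //; exact: L2B.
Qed.

Lemma radial_limitD a b F G f g : radial_limit a F f -> radial_limit b G g ->
  radial_limit (fun n => a n + b n) (fun z => F z + G z) (fun t => f t + g t).
Proof.
move=> [aF f2 cf] [bG g2 cg]; split; [exact: disc_seriesD|exact: L2D|].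
move=> e e0; have e4 : 0 < e / 4 by rewrite divr_gt0.
apply: filterS3 near_left1_in01 (cf _ e4) (cg _ e4) => r /andP[r0 r1] h1 h2.
have r01 : 0 <= r < 1 by rewrite ltW.
have := energyD (L2B (L2_dilate aF r01) f2) (L2B (L2_dilate bG r01) g2).
rewrite (_ : (fun t => _ + _) =
    (fun t => dilate (fun z => F z + G z) r t - (f t + g t))).
  by lra.
by apply/funext => t; rewrite /dilate; ring.
Qed.

Lemma radial_limitZ a F f (c : R[i]) : radial_limit a F f ->
  radial_limit (fun n => c * a n) (fun z => c * F z) (fun t => c * f t).
Proof.
move=> [aF f2 cf]; split; [exact: disc_seriesZ|exact: L2Z|].
move=> e e0; have c1 : 0 < normc c ^+ 2 + 1 by rewrite ltr_wpDl // sqr_ge0.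
have e4 : 0 < e / (normc c ^+ 2 + 1) by rewrite divr_gt0.
apply: filterS2 near_left1_in01 (cf _ e4) => r /andP[r0 r1] h1.
have r01 : 0 <= r < 1 by rewrite ltW.
have := energyZ c (L2B (L2_dilate aF r01) f2).
rewrite (_ : (fun t => _ * _) = (fun t => dilate (fun z => c * F z) r t - c * f t)).
  move=> ->; move: h1; rewrite ltr_pdivlMr // mulrDr mulr1 => h1.
  rewrite mulrC; apply: le_lt_trans h1; rewrite lerDl; exact: energy_ge0.
by apply/funext => t; rewrite /dilate mulrBr.
Qed.

Lemma radial_limit_cst (c : R[i]) :
  radial_limit (fun n => if n is 0 then c else 0) (fun=> c) (fun=> c).
Proof.
split; [exact: disc_series_cst|exact: L2_cst|].
move=> e e0; apply: nearW => r.
rewrite /dilate subrr /energy L2normsq_cst Normc.normc0 expr0n //.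
Qed.

(** The multiplication by z and the backward shift change a dilate by a factor
    r or 1/r; the last bound controls the error (1 - r) f this makes. *)
Lemma radial_limit_near a F f (e : R) : radial_limit a F f -> 0 < e ->
  \forall r \near (1 : R)^'-, [/\ 1/2 < r, r < 1,
    energy (fun t => dilate F r t - f t) < e & (1 - r) ^+ 2 * energy f < e].
Proof.
move=> [aF f2 cf] e0; have E0 := energy_ge0 f.
have E1 : 0 < energy f + 1 by lra.
have d0 : 0 < e / (energy f + 1) by rewrite divr_gt0.
have h12 : 1/2 < 1 :> R by lra.
apply: filterS3 (filterI (nbhs_left_gt h12) (nbhs_left_lt (1 : R)))
  (nbhs_left_ltBl (1 : R) d0) (cf e e0) => r [h1 h2] h3 h4; split => //.
move: h3; rewrite ltr_pdivlMr // => h3; nra.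
Qed.

Lemma radial_limit_mulX a F f : radial_limit a F f ->
  radial_limit (fun n => if n is m.+1 then a m else 0) (fun z => z * F z)
    (fun t => cis t * f t).
Proof.
move=> H; have [aF f2 cf] := H.
have xf2 : L2 (fun t => cis t * f t) by exact: L2_Linfty (@Linfty_cis R) f2.
split => //; first exact: disc_series_mulX.
move=> e e0; have e4 : 0 < e / 4 by rewrite divr_gt0.
apply: filterS (radial_limit_near H e4) => r [r0 r1 h1 h2].
have r01 : 0 <= r < 1 by apply/andP; split; lra.
have d2 := L2_dilate aF r01.
have := @energy_leD (fun t => dilate F r t - f t) (fun t => (1 - r)%:C * f t)
  (fun t => dilate (fun z => z * F z) r t - cis t * f t).
rewrite energyZ // normcR real_normK ?num_real // => H1.
apply: le_lt_trans (H1 _ _ _ _) _; last lra.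
- exact: L2B.
- exact: L2Z.
- by apply: L2B xf2; exact: (L2_dilate (disc_series_mulX aF) r01).
move=> t.
have -> : dilate (fun z => z * F z) r t - cis t * f t =
    cis t * (r%:C * (dilate F r t - f t) - (1 - r)%:C * f t).
  by rewrite /dilate rmorphB rmorph1; ring.
rewrite Normc.normcM normc_cis mul1r (le_trans (normcB _ _)) // lerD2r.
rewrite Normc.normcM normcR ger0_norm; last lra.
by rewrite ler_piMl ?normc_ge0 //; lra.
Qed.

(** On the circle of radius r, S^* F is F / (r z), and 1/r <= 2 near the
    boundary, so the distance to z^* f is at most 2 |F_r - f| + 2 (1 - r) |f|. *)
Lemma radial_limit_backward_shift a F f : radial_limit a F f -> F 0 = 0 ->
  radial_limit (fun n => a n.+1) (backward_shift F) (fun t => (cis t)^*%C * f t).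
Proof.
move=> H F0; have [aF f2 cf] := H.
have xf2 : L2 (fun t => (cis t)^*%C * f t).
  exact: L2_Linfty (Linfty_conj (@Linfty_cis R)) f2.
have bG : disc_series (fun n => a n.+1) (backward_shift F).
  apply: (disc_series_div aF); rewrite /backward_shift.
    by rewrite eqxx (disc_series_derive aF).
  by move=> z /negPf ->.
split => //.
move=> e e0; have e4 : 0 < e / 16 by rewrite divr_gt0.
apply: filterS (radial_limit_near H e4) => r [r0 r1 h1 h2].
have r01 : 0 <= r < 1 by apply/andP; split; lra.
have d2 := L2_dilate aF r01.
have := @energy_leD (fun t => 2%:C * (dilate F r t - f t))
  (fun t => (2 * (1 - r))%:C * f t)
  (fun t => dilate (backward_shift F) r t - (cis t)^*%C * f t).
rewrite !energyZ //; last exact: L2B.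
rewrite !normcR !real_normK ?num_real // => H1.
apply: le_lt_trans (H1 _ _ _ _) _; last by rewrite exprMn; lra.
- exact/L2Z/L2B.
- exact: L2Z.
- by apply: L2B xf2; exact: (L2_dilate bG r01).
move=> t.
have rn0 : r%:C != 0 :> R[i] by rewrite eq_complex /= negb_and gt_eqF //; lra.
have cn0 : cis t != 0.
  apply/eqP => c0; have := normc_cis t; rewrite c0 Normc.normc0 => /eqP.
  by rewrite eq_sym oner_eq0.
have -> : dilate (backward_shift F) r t - (cis t)^*%C * f t =
    (cis t)^*%C * (r^-1)%:C * ((dilate F r t - f t) + (1 - r)%:C * f t).
  have zn0 : (r%:C * cis t == 0) = false.
    by rewrite mulf_eq0 (negPf rn0) (negPf cn0).
  rewrite /dilate /backward_shift zn0 F0 subr0.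
  have -> : conjc (cis t) = (cis t)^-1.
    by apply: (mulfI cn0); rewrite cis_conj divff.
  rewrite fmorphV rmorphB rmorph1; field.
  by rewrite rn0 cn0.
rewrite !Normc.normcM normc_conj normc_cis mul1r !normcR.
rewrite ger0_norm; last by rewrite invr_ge0; lra.
rewrite (ger0_norm (_ : 0 <= 2)) // ger0_norm; last lra.
have ri : r^-1 <= 2.
  by rewrite -[leRHS]invrK lef_pV2 ?posrE ?invr_gt0 //; lra.
have := normcD (dilate F r t - f t) ((1 - r)%:C * f t).
rewrite Normc.normcM normcR ger0_norm; last lra.
set x := normc (_ + _); set y := normc (_ - _); set w := normc (f t) => h.
apply: (@le_trans _ _ (2 * x)); first by rewrite ler_wpM2r // normc_ge0.
nra.
Qed.

Lemma complex_cauchy (v : nat -> R[i]) :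
  (forall e : R, 0 < e -> exists N, forall n, (N <= n)%N -> normc (v n - v N) < e) ->
  exists l, forall e : R, 0 < e -> \forall n \near \oo, normc (l - v n) < e.
Proof.
move=> H.
have key (p : R[i] -> R) : (forall z w, `|p z - p w| <= normc (z - w)) ->
    cvgn (p \o v).
  move=> hp; apply/cauchy_cvgP/cauchy_exP => e e0.
  have [N NP] := H e e0; exists (p (v N)); exists N => // n /= Nn.
  by rewrite /ball /= distrC (le_lt_trans (hp _ _)) // NP.
have /key cR : forall z w, `|Re z - Re w| <= normc (z - w).
  by move=> z w; rewrite -complex_ReB; exact: le_normr_Re.
have /key cI : forall z w, `|Im z - Im w| <= normc (z - w).
  by move=> z w; rewrite -complex_ImB; exact: le_normr_Im.
exists (limn (@complex.Re R \o v) +i* limn (@complex.Im R \o v)) => e e0.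
have e2 : 0 < e / 2 by rewrite divr_gt0.
move/cvgrPdist_lt: cR => /(_ _ e2); move/cvgrPdist_lt: cI => /(_ _ e2).
apply: filterS2 => n /= h1 h2.
rewrite (le_lt_trans (normc_le_ReIm _)) // [ltRHS](splitr e).
by case: (v n) h1 h2 => x y /= h1 h2; rewrite ltrD.
Qed.

Lemma boundary_ae F f g : boundary F f -> L2 g -> ae_circle (fun t => f t = g t) ->
  boundary F g.
Proof.
move=> /boundaryP[a [aF f2 cf]] g2 fg; apply/boundaryP; exists a; split => // e e0.
apply: filterS2 near_left1_in01 (cf e e0) => r /andP[r0 r1].
have r01 : 0 <= r < 1 by rewrite ltW.
have d2 := L2_dilate aF r01.
rewrite /energy (@L2normsq_eq _ _ (fun t => dilate F r t - g t)) //.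
- exact: L2_measurable (L2B d2 f2).
- exact: L2_measurable (L2B d2 g2).
- by apply: ae_circleS fg => t ->.
Qed.

(** H^2 is closed in L^2, together with the continuity of evaluation at 0,
    which is what makes H^2_0 closed as well.

    Since coefficients are controlled by boundary norms, each coefficient
    sequence a_n(k) is Cauchy; its limit A(k) satisfies
    sum_k |A(k) - a_n(k)|^2 <= 16 |u_n - f|^2.  The series V with coefficients
    A then has dilates uniformly close to those of U_n, and these are close to
    u_n near the boundary. *)
Lemma boundary_closed (U : nat -> R[i] -> R[i]) (u : nat -> R -> R[i]) f :
  (forall n, boundary (U n) (u n)) -> L2 f -> L2cvg u f ->
  exists2 V, boundary V f &
    forall e : R, 0 < e -> \forall n \near \oo, normc (V 0 - U n 0) < e.
Proof.
move=> Uu f2 /L2normsq_cvg0P uf.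
have /choice[a aU] n := (boundaryP _ _).1 (Uu n).
have u2 n : L2 (u n) by have [] := aU n.
have aD n := let: And3 x _ _ := aU n in x.
pose d n := energy (fun t => u n t - f t).
have d0 n : 0 <= d n by exact: energy_ge0.
have dP e : 0 < e -> \forall n \near \oo, d n < e.
  move=> /uf; apply: filterS => n; rewrite L2normsq_energy ?lte_fin //.
  exact: L2B.
have diff N n m : \sum_(0 <= k < N) normc (a n k - a m k) ^+ 2 <= 8 * (d n + d m).
  have H := radial_limitD (aU n) (radial_limitZ (-1) (aU m)).
  have := coef_le_energy N H.
  have := energyB (L2B (u2 n) f2) (L2B (u2 m) f2).
  rewrite (_ : (fun t => _ - _) = (fun t => u n t + -1 * u m t)); last first.
    by apply/funext => t; ring.
  under [X in X <= 4 * _ -> _]eq_bigr do rewrite mulN1r.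
  by rewrite -/(d n) -/(d m); lra.
have diff1 k n m : normc (a n k - a m k) ^+ 2 <= 8 * (d n + d m).
  apply: le_trans (diff k.+1 n m); rewrite big_nat_recr //= lerDr.
  by apply: sumr_ge0 => i _; rewrite sqr_ge0.
have /choice[A AP] k : exists l, forall e : R, 0 < e ->
    \forall n \near \oo, normc (l - a n k) < e.
  apply: complex_cauchy => e e0.
  have e16 : 0 < e ^+ 2 / 16 by rewrite divr_gt0 // exprn_gt0.
  have [N _ NP] := dP _ e16; exists N => n Nn.
  have := diff1 k n N; have := NP n Nn; have := NP N (leqnn N) => /= h1 h2 h3.
  rewrite -(@ltr_pXn2r _ 2) ?nnegrE ?normc_ge0 ?ltW //; lra.
have limsum N e : 0 < e ->
    \forall m \near \oo, \sum_(0 <= k < N) normc (A k - a m k) ^+ 2 < e.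
  elim: N e => [|N IH] e e0; first by apply: nearW => m; rewrite big_nil.
  have e2 : 0 < e / 2 by rewrite divr_gt0.
  have m0 : 0 < Num.min 1 (e / 2) by rewrite lt_min ltr01.
  apply: filterS2 (IH _ e2) (AP N _ m0) => m h1; rewrite lt_min => /andP[h2 h3].
  rewrite big_nat_recr //= [ltRHS](splitr e) ltrD //.
  have := normc_ge0 (A N - a m N); nra.
have A_a N n : \sum_(0 <= k < N) normc (A k - a n k) ^+ 2 <= 16 * d n.
  apply/ler_addgt0Pr => e e0; have e20 : 0 < e / 20 by rewrite divr_gt0.
  have [m [/= h1 h2]] := filter_ex (filterI (limsum N _ e20) (dP _ e20)).
  apply: (@le_trans _ _ (2 * (\sum_(0 <= k < N) normc (A k - a m k) ^+ 2 +
      \sum_(0 <= k < N) normc (a m k - a n k) ^+ 2))).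
    rewrite -big_split mulr_sumr; apply: ler_sum => k _ /=.
    have := normcD (A k - a m k) (a m k - a n k); rewrite addrA subrK.
    have := normc_ge0 (A k - a m k); have := normc_ge0 (a m k - a n k).
    have := normc_ge0 (A k - a n k).
    set x := normc _; set y := normc _; set w := normc _ => x0 y0 w0 le.
    have := sqr_ge0 (y - w); nra.
  have := diff N m n; lra.
(* x <= 1 + x^2 turns the bounds on squares into bounds on the coefficients *)
have [|V AV] := @bounded_coef_disc_series _ A (2 + 16 * d 0%N + 4 * energy (u 0%N)).
  move=> k.
  have h1 : normc (A k - a 0%N k) ^+ 2 <= 16 * d 0%N.
    apply: le_trans (A_a k.+1 0%N); rewrite big_nat_recr //= lerDr.
    by apply: sumr_ge0 => i _; rewrite sqr_ge0.
  have h2 : normc (a 0%N k) ^+ 2 <= 4 * energy (u 0%N).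
    apply: le_trans (coef_le_energy k.+1 (aU 0%N)); rewrite big_nat_recr //= lerDr.
    by apply: sumr_ge0 => i _; rewrite sqr_ge0.
  have := normcD (A k - a 0%N k) (a 0%N k); rewrite subrK.
  have := sqr_ge0 (normc (A k - a 0%N k) - 1).
  have := sqr_ge0 (normc (a 0%N k) - 1).
  nra.
(* evaluation at 0 is the coefficient of index 0 *)
exists V; last first.
  move=> e e0; have := AP 0%N e e0; apply: filterS => n.
  by rewrite (disc_series0 AV) (disc_series0 (aD n)).
apply/boundaryP; exists A; split => // e e0.
(* V_r - f = (V - U_n)_r + ((U_n)_r - u_n) + (u_n - f) *)
have e0' : 0 < e / 100 by rewrite divr_gt0.
have [n /= dn] := filter_ex (dP _ e0').
have [_ _ /(_ _ e0')] := aU n; apply: filterS2 near_left1_in01 => r /andP[r0 r1] h.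
have r01 : 0 <= r < 1 by rewrite ltW.
have V2 := L2_dilate AV r01; have U2 := L2_dilate (aD n) r01.
have AaV : disc_series (fun k => A k + -1 * a n k) (fun z => V z + -1 * U n z).
  exact: disc_seriesD AV (disc_seriesZ (-1) (aD n)).
have k1 : energy (dilate (fun z => V z + -1 * U n z) r) <= 2 * (16 * d n).
  apply: energy_dilate_le_coef AaV r01 _ => N.
  by under eq_bigr do rewrite mulN1r; exact: A_a.
have k2 := energyD (L2B U2 (u2 n)) (L2B (u2 n) f2).
have k3 := energyD (L2_dilate AaV r01) (L2D (L2B U2 (u2 n)) (L2B (u2 n) f2)).
move: k3; rewrite (_ : (fun t => _) = (fun t => dilate V r t - f t)); last first.
  by apply/funext => t; rewrite /dilate; ring.
move: k2; rewrite -/(d n); lra.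
Qed.

End RadialLimits.

(** * The model space and the kernel of the truncated Toeplitz operator *)

Section ToeplitzKernel.
Variable R : realType.
Implicit Types (f g h theta : R -> R[i]) (z w : R[i]) (a b : nat -> R[i]).
Implicit Types (F G : R[i] -> R[i]).
Local Notation mu := (@lebesgue_measure R).
Local Notation circle := (@circle R).

Lemma boundary_L2 F f : boundary F f -> L2 f. Proof. by case. Qed.

Lemma boundaryD F G f g : boundary F f -> boundary G g ->
  boundary (fun z => F z + G z) (fun t => f t + g t).
Proof.
move=> /boundaryP[a aF] /boundaryP[b bG]; apply/boundaryP.
by eexists; exact: radial_limitD aF bG.
Qed.

Lemma boundaryZ (c : R[i]) F f : boundary F f ->
  boundary (fun z => c * F z) (fun t => c * f t).
Proof.
move=> /boundaryP[a aF]; apply/boundaryP.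
by eexists; exact: radial_limitZ aF.
Qed.

Lemma boundary_cst (c : R[i]) : boundary (fun=> c) (fun=> c).
Proof. by apply/boundaryP; eexists; exact: radial_limit_cst. Qed.

Lemma boundaryB F G f g : boundary F f -> boundary G g ->
  boundary (fun z => F z - G z) (fun t => f t - g t).
Proof.
move=> Ff Gg; have := boundaryD Ff (boundaryZ (-1) Gg).
rewrite (_ : (fun z => _ + _) = (fun z => F z - G z)); last first.
  by apply/funext => z; rewrite mulN1r.
rewrite (_ : (fun t => _ + _) = (fun t => f t - g t)) //.
by apply/funext => t; rewrite mulN1r.
Qed.

Lemma boundary_mulX F f : boundary F f ->
  boundary (fun z => z * F z) (fun t => cis t * f t).
Proof.
move=> /boundaryP[a aF]; apply/boundaryP.
by eexists; exact: radial_limit_mulX aF.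
Qed.

Lemma boundary_backward_shift F f : boundary F f -> F 0 = 0 ->
  boundary (backward_shift F) (fun t => (cis t)^*%C * f t).
Proof.
move=> /boundaryP[a aF] F0; apply/boundaryP.
by eexists; exact: radial_limit_backward_shift aF F0.
Qed.

Lemma L2inner_ae f g f' g' : measurable_circle f -> measurable_circle g ->
  measurable_circle f' -> measurable_circle g' ->
  ae_circle (fun t => f t * (g t)^*%C = f' t * (g' t)^*%C) ->
  L2inner f g = L2inner f' g'.
Proof.
move=> mf mg mf' mg' H; rewrite /L2inner; congr (_ * _).
by apply: circle_integral_ae => //;
  apply: measurable_circleM => //; exact: measurable_circle_conj.
Qed.

(** The expansion of |f - l <f, g> g|^2, with w, x, y standing for <f, g>,
    <f, f>, <g, g>. *)
Lemma completed_square (w x y : R[i]) (l : R) (c := (- l)%:C * w) :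
  Re (x + c^*%C * w + (c * w^*%C + c * (c^*%C * y))) =
  Re x - 2 * l * normc w ^+ 2 + l ^+ 2 * normc w ^+ 2 * Re y.
Proof.
rewrite sqr_normcE /c {c}.
by case: w => w1 w2; case: x => x1 x2; case: y => y1 y2 /=; ring.
Qed.

(** A weak Cauchy-Schwarz inequality: |f - l <f, g> g|^2 >= 0 with
    l = 1 / (|g|^2 + 1), a choice that needs no case distinction on |g| = 0. *)
Lemma L2inner_sqr_le f g : L2 f -> L2 g ->
  normc (L2inner f g) ^+ 2 <= (energy g + 1) * energy f.
Proof.
move=> f2 g2; set w := L2inner f g.
have Eg := energy_ge0 g; have Eg1 : 0 < energy g + 1 by lra.
pose l : R := (energy g + 1)^-1; pose c : R[i] := (- l)%:C * w.
have l0 : 0 < l by rewrite invr_gt0.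
have lE : l * (energy g + 1) = 1 by rewrite mulVf // gt_eqF.
have key : energy (fun t => f t + c * g t) =
    energy f - 2 * l * normc w ^+ 2 + l ^+ 2 * normc w ^+ 2 * energy g.
  have cg2 := L2Z c g2; have k2 := L2D f2 cg2.
  have Rin k : L2 k -> energy k = Re (L2inner k k).
    by move=> k2'; rewrite /energy L2normsq_inner.
  rewrite !Rin // L2innerDl // !L2innerDr // !L2innerZl // !L2innerZr //.
  by rewrite (L2inner_conj f2 g2) -/w completed_square.
have := energy_ge0 (fun t => f t + c * g t); rewrite key.
set W := normc w ^+ 2; have W0 : 0 <= W by exact: sqr_ge0.
move=> H; have h1 : l * W <= energy f.
  have : l ^+ 2 * W * energy g = l * W - l ^+ 2 * W.
    by rewrite -[in RHS](mulr1 (l * W)) -lE; ring.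
  by have := mulr_ge0 (sqr_ge0 l) W0; lra.
by rewrite -(ler_pM2l l0) [leRHS]mulrA lE mul1r.
Qed.

Lemma L2inner_cvg0 (u : nat -> R -> R[i]) f g : (forall n, L2 (u n)) -> L2 f -> L2 g ->
  L2cvg u f -> (forall n, L2inner (u n) g = 0) -> L2inner f g = 0.
Proof.
move=> u2 f2 g2 /L2normsq_cvg0P uf u0; apply/Normc.eq0_normc/eqP.
have Eg1 : 0 < energy g + 1 by have := energy_ge0 g; lra.
rewrite -sqrf_eq0 eq_le sqr_ge0 andbT; apply/ler_addgt0Pr => e e0; rewrite add0r.
have [n /=] := filter_ex (uf _ (divr_gt0 e0 Eg1)).
rewrite (L2normsq_energy (L2B (u2 n) f2)) lte_fin ltr_pdivlMr // mulrC => /ltW.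
apply: le_trans; apply: le_trans (L2inner_sqr_le (L2B (u2 n) f2) g2).
have -> : (fun t => u n t - f t) = (fun t => u n t + -1 * f t).
  by apply/funext => t; rewrite mulN1r.
by rewrite L2innerDl ?L2innerZl ?u0 ?add0r ?mulN1r ?normcN //; exact: L2Z.
Qed.

Lemma inner_function_boundary theta : inner_function theta ->
  exists Theta, boundary Theta theta.
Proof. by case=> -[F Ff _] _; exists F. Qed.

Lemma inner_functionK theta : inner_function theta ->
  ae_circle (fun t => theta t * (theta t)^*%C = 1).
Proof.
by move=> [_]; apply: ae_circleS => t h; rewrite normc_mul_conj h expr1n.
Qed.

Lemma inner_function_Linfty theta : inner_function theta -> Linfty theta.
Proof.
move=> th; have [Th /boundary_L2 /L2_measurable mth] := inner_function_boundary th.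
split => //; exists 1; case: th => _; apply: ae_circleS => t -> //.
Qed.

(** Conjugation f |-> theta f^* is an involution, by unimodularity of theta. *)
Lemma inner_conj_sym theta f h : inner_function theta ->
  ae_circle (fun t => f t = theta t * (h t)^*%C) ->
  ae_circle (fun t => h t = theta t * (f t)^*%C).
Proof.
move=> th; apply: ae_circleS2 (inner_functionK th) => t th1 ->.
by rewrite conjcM conjcK mulrA th1 mul1r.
Qed.

Lemma model_space_L2 theta f : model_space theta f -> L2 f.
Proof. by move=> [[F /boundary_L2]]. Qed.

Lemma model_space_cst0 theta : model_space theta (fun=> 0).
Proof.
split; first by exists (fun=> 0); exact: boundary_cst.
exists (fun=> 0); first by exists (fun=> 0) => //; exact: boundary_cst.
by apply: ae_circle_all => t _; rewrite conjc0 mulr0.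
Qed.

Lemma model_spaceD theta f g : model_space theta f -> model_space theta g ->
  model_space theta (fun t => f t + g t).
Proof.
move=> [[F Ff] [h [H Hh H0] fh]] [[G Gg] [k [K Kk K0] gk]]; split.
  by eexists; exact: boundaryD Ff Gg.
exists (fun t => h t + k t).
  by eexists; [exact: boundaryD Hh Kk|rewrite /= H0 K0 addr0].
by apply: ae_circleS2 fh gk => t -> ->; rewrite conjcD mulrDr.
Qed.

Lemma model_spaceZ theta (c : R[i]) f : model_space theta f ->
  model_space theta (fun t => c * f t).
Proof.
move=> [[F Ff] [h [H Hh H0] fh]]; split; first by eexists; exact: boundaryZ Ff.
exists (fun t => c^*%C * h t).
  by eexists; [exact: boundaryZ Hh|rewrite /= H0 mulr0].
by apply: ae_circleS fh => t ->; rewrite conjcM conjcK mulrCA.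
Qed.

(** Conjugation is isometric, so the conjugates theta u_n^* converge too; they
    are in H^2_0, which is closed. *)
Lemma model_space_closed theta (u : nat -> R -> R[i]) f : inner_function theta ->
  (forall n, model_space theta (u n)) -> L2 f -> L2cvg u f -> model_space theta f.
Proof.
move=> th uM f2 uf.
have uB n : exists F, boundary F (u n) by case: (uM n).
have /choice[U Uu] := uB.
have [V Vf _] := boundary_closed Uu f2 uf; split; first by exists V.
pose v n t := theta t * (u n t)^*%C; pose h t := theta t * (f t)^*%C.
have thL := inner_function_Linfty th.
have v2 n : L2 (v n) by exact: L2_Linfty thL (L2_conj (boundary_L2 (Uu n))).
have h2 : L2 h by exact: L2_Linfty thL (L2_conj f2).
have /choice[K Kv] n : exists K, boundary K (v n) /\ K 0 = 0.
  have [_ [k [K Kk K0] uk]] := uM n; exists K; split => //.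
  exact: boundary_ae Kk (v2 n) (inner_conj_sym th uk).
have vh : L2cvg v h.
  rewrite /L2cvg (_ : (fun n => _) = fun n => L2normsq (fun t => u n t - f t)) //.
  apply/funext => n; apply/esym; apply: L2normsq_eq.
  - exact: L2_measurable (L2B (boundary_L2 (Uu n)) f2).
  - exact: L2_measurable (L2B (v2 n) h2).
  case: (th) => _; apply: ae_circleS => t h1.
  rewrite /v /h -mulrBr Normc.normcM h1 mul1r -normc_conj; congr normc.
  exact: conjcB.
have [H Hh H0] := boundary_closed (fun n => (Kv n).1) h2 vh.
exists h.
  exists H => //; apply/Normc.eq0_normc/eqP.
  rewrite eq_le normc_ge0 andbT; apply/ler_addgt0Pr => e e0; rewrite add0r.
  have [n /=] := filter_ex (H0 e e0).
  by rewrite (Kv n).2 subr0 => /ltW.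
apply: ae_circleS (inner_functionK th) => t h1.
by rewrite /h conjcM conjcK mulrA h1 mul1r.
Qed.

Lemma ker_truncated_toeplitzP theta g f :
  ker_truncated_toeplitz theta g f <-> model_space theta f /\
    forall psi, model_space theta psi -> L2inner (fun t => g t * f t) psi = 0.
Proof.
rewrite /ker_truncated_toeplitz /truncated_toeplitz /is_orth_proj /=.
under [X in L2inner X]eq_fun do rewrite subr0.
split=> [[fM [_ H]]//|[fM H]]; split => //; split => //.
exact: model_space_cst0.
Qed.

Lemma ker_sub_model_space theta g f : ker_truncated_toeplitz theta g f ->
  model_space theta f.
Proof. by move=> /ker_truncated_toeplitzP[]. Qed.

(** Orthogonality to psi passes to the limit because multiplication by g is
    bounded on L^2. *)
Lemma ker_closed_subspace theta g : inner_function theta -> Linfty g ->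
  closed_subspace (ker_truncated_toeplitz theta g).
Proof.
move=> th gL.
have gL2 f : model_space theta f -> L2 (fun t => g t * f t).
  by move=> /model_space_L2; exact: L2_Linfty.
split.
- apply/ker_truncated_toeplitzP; split; first exact: model_space_cst0.
  move=> psi /model_space_L2 psi2.
  rewrite (_ : (fun t => g t * 0) = (fun t => 0 * (fun=> 0) t)).
    by rewrite L2innerZl ?mul0r //; exact: L2_cst.
  by apply/funext => t; rewrite mulr0 mul0r.
- move=> f h /ker_truncated_toeplitzP[fM fK] /ker_truncated_toeplitzP[hM hK].
  apply/ker_truncated_toeplitzP; split; first exact: model_spaceD.
  move=> psi psiM.
  rewrite (_ : (fun t => _) = (fun t => g t * f t + g t * h t)).
    rewrite L2innerDl ?fK ?hK ?addr0 //; try exact: gL2.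
    exact: model_space_L2 psiM.
  by apply/funext => t; rewrite mulrDr.
- move=> c f /ker_truncated_toeplitzP[fM fK].
  apply/ker_truncated_toeplitzP; split; first exact: model_spaceZ.
  move=> psi psiM.
  rewrite (_ : (fun t => _) = (fun t => c * (g t * f t))).
    rewrite L2innerZl ?fK ?mulr0 //; first exact: gL2.
    exact: model_space_L2 psiM.
  by apply/funext => t; rewrite mulrCA.
move=> u f uK f2 uf.
have uM n : model_space theta (u n) by have /ker_truncated_toeplitzP[] := uK n.
apply/ker_truncated_toeplitzP; split; first exact: model_space_closed uM f2 uf.
move=> psi psiM; have psi2 := model_space_L2 psiM.
apply: (@L2inner_cvg0 (fun n t => g t * u n t)).
- by move=> n; exact: gL2.
- exact: L2_Linfty.
- by [].
- have [mg [C gC]] := gL.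
  pose D := Num.max C 0; have D0 : 0 <= D by rewrite le_max lexx orbT.
  have D1 : 0 < D ^+ 2 + 1 by rewrite ltr_wpDl // sqr_ge0.
  apply/L2normsq_cvg0P => e e0; have /L2normsq_cvg0P uf' := uf.
  have := uf' _ (divr_gt0 e0 D1); apply: filterS => n h.
  have d2 := L2B (model_space_L2 (uM n)) f2.
  have gd2 := L2B (gL2 _ (uM n)) (L2_Linfty gL f2).
  apply: le_lt_trans (@L2normsq_le _ D _ (fun t => u n t - f t) _ _ _ _) _.
  + exact: L2_measurable gd2.
  + exact: L2_measurable d2.
  + exact: D0.
  + apply: ae_circleS gC => t gC; rewrite -mulrBr Normc.normcM.
    by rewrite ler_wpM2r ?normc_ge0 // /D le_max gC.
  move: h; rewrite (L2normsq_energy d2) -EFinM !lte_fin ltr_pdivlMr // => h.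
  by have := energy_ge0 (fun t => u n t - f t); lra.
- by move=> n; have /ker_truncated_toeplitzP[_] := uK n; exact.
Qed.

(** The function h - F(0)^* theta is the conjugate theta (f - F(0))^*, and
    f - F(0) vanishes at the origin.  Taking f in K gives the test functions of
    [ker_pairing_sym]; taking f = S^* chi gives [shift_sub_model_space]. *)
Lemma conjugate_sub_model_space theta F f H h : inner_function theta ->
  boundary F f -> boundary H h -> ae_circle (fun t => f t = theta t * (h t)^*%C) ->
  model_space theta (fun t => h t - (F 0)^*%C * theta t).
Proof.
move=> th Ff Hh fh; have [Th Thth] := inner_function_boundary th; split.
  by eexists; exact: boundaryB Hh (boundaryZ _ Thth).
exists (fun t => f t - F 0).
  by eexists; [exact: boundaryB Ff (boundary_cst (F 0))|rewrite /= subrr].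
apply: ae_circleS (inner_conj_sym th fh) => t ->.
by rewrite conjcB mulrBr [theta t * (F 0)^*%C]mulrC.
Qed.

(** Both sides equal the integral of g f1 f2 theta^*, which is symmetric in f1
    and f2. *)
Lemma ker_pairing_sym theta g F1 F2 f1 f2 : inner_function theta -> Linfty g ->
  ker_truncated_toeplitz theta g f1 -> ker_truncated_toeplitz theta g f2 ->
  boundary F1 f1 -> boundary F2 f2 ->
  F2 0 * L2inner (fun t => g t * f1 t) theta =
  F1 0 * L2inner (fun t => g t * f2 t) theta.
Proof.
move=> th gL /ker_truncated_toeplitzP[M1 K1] /ker_truncated_toeplitzP[M2 K2] Ff1 Ff2.
have [_ [h1 [H1 Hh1 _] fh1]] := M1; have [_ [h2 [H2 Hh2 _] fh2]] := M2.
have th2 : L2 theta by have [? /boundary_L2] := inner_function_boundary th.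
have gf1 := L2_Linfty gL (boundary_L2 Ff1).
have gf2 := L2_Linfty gL (boundary_L2 Ff2).
have step f F h : L2 f -> L2 h -> L2inner f (fun t => h t - (F 0)^*%C * theta t) = 0 ->
    F 0 * L2inner f theta = L2inner f h.
  move=> f_2 h_2.
  rewrite (_ : (fun t => _ - _) = (fun t => h t + - (F 0)^*%C * theta t)).
    rewrite L2innerDr ?L2innerZr //; last exact: L2Z.
    rewrite conjcN conjcK mulNr => /eqP.
    by rewrite subr_eq0 => /eqP.
  by apply/funext => t; rewrite mulNr.
have h12 := boundary_L2 Hh1; have h22 := boundary_L2 Hh2.
rewrite (step _ F2 h2) ?(step _ F1 h1) //.
- have mL2 := @L2_measurable R; apply: L2inner_ae; try exact: mL2.
  apply: ae_circleS2 (inner_conj_sym th fh1) (inner_conj_sym th fh2) => t -> ->.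
  by rewrite !conjcM !conjcK; ring.
- by apply: K2; exact: conjugate_sub_model_space Ff1 Hh1 fh1.
- by apply: K1; exact: conjugate_sub_model_space Ff2 Hh2 fh2.
Qed.

(** If psi = theta chi^* with chi(0) = 0, then z psi is the conjugate of
    z^* chi = S^* chi, a function of H^2 that may fail to vanish at 0; removing
    its value there costs a multiple of theta. *)
Lemma shift_sub_model_space theta psi : inner_function theta -> model_space theta psi ->
  exists c : R[i], model_space theta (fun t => cis t * psi t - c * theta t).
Proof.
move=> th [[Psi Ppsi] [chi [X Xchi X0] pc]].
have B := boundary_backward_shift Xchi X0.
exists (backward_shift X 0)^*%C.
apply: (conjugate_sub_model_space th B (boundary_mulX Ppsi)).
apply: ae_circleS (inner_conj_sym th pc) => t ->.
by rewrite conjcM; ring.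
Qed.

Lemma model_space_backward_shift theta F f : inner_function theta ->
  boundary F f -> F 0 = 0 -> model_space theta f ->
  model_space theta (fun t => (cis t)^*%C * f t).
Proof.
move=> th Ff F0 [_ [h [H Hh _] fh]]; split.
  by eexists; exact: boundary_backward_shift Ff F0.
exists (fun t => cis t * h t).
  by eexists; [exact: boundary_mulX Hh|rewrite /= mul0r].
by apply: ae_circleS fh => t ->; rewrite conjcM mulrCA.
Qed.

End ToeplitzKernel.

Theorem theorem4p4 (R : realType) (theta g : R -> R[i])
    (htheta : inner_function theta) (hg : Linfty g)
    (hker : exists F : R[i] -> R[i],
       disc_functions (ker_truncated_toeplitz theta g) F /\ F 0 <> 0) :
  nearly_Sstar_invariant (ker_truncated_toeplitz theta g).
Proof.
split.
- by move=> f /ker_sub_model_space[].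
- exact: ker_closed_subspace.
move=> F [f Ff fK] F0; exists (fun t => (cis t)^*%C * f t).
  exact: boundary_backward_shift.
have /ker_truncated_toeplitzP[fM fK0] := fK.
apply/ker_truncated_toeplitzP; split; first exact: model_space_backward_shift Ff F0 fM.
move=> psi psiM.
have [F1 [[f1 Ff1 f1K] F10]] := hker.
(* symmetry against f1, which does not vanish at the origin *)
have gft : L2inner (fun t => g t * f t) theta = 0.
  have := ker_pairing_sym htheta hg fK f1K Ff Ff1.
  rewrite F0 mul0r => /eqP; rewrite mulf_eq0 => /orP[/eqP//|/eqP //].
have gf2 := L2_Linfty hg (boundary_L2 Ff).
have psi2 := model_space_L2 psiM.
have th2 : L2 theta by have [? /boundary_L2] := inner_function_boundary htheta.
have zpsi2 := L2_Linfty (@Linfty_cis R) psi2.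
have [c cM] := shift_sub_model_space htheta psiM.
have : L2inner (fun t => g t * f t) (fun t => cis t * psi t) = 0.
  have := fK0 _ cM.
  rewrite (_ : (fun t => _ - _) = (fun t => cis t * psi t + - c * theta t)).
    by rewrite L2innerDr ?L2innerZr ?gft ?mulr0 ?addr0 //; exact: L2Z.
  by apply/funext => t; rewrite mulNr.
move=> <-; rewrite /L2inner; congr (_ * circle_integral _).
by apply/funext => t; rewrite conjcM; ring.
Qed.
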